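(* Let $Z=\{P_1,\dots,P_r\}\subset\mathbb{P}^2$ be a finite set of points. If $\alpha(I(kZ))-\alpha(I((k-1)Z))=1$ for some integer $k\ge2$, then either (a) the points of $Z$ are collinear, or (b) $Z$ consists of all intersection points of some arrangement of lines (which might be non-reduced and degenerate, i.e. containing points through which more than two lines pass).
   Context: Work over an algebraically closed field $\mathbb{K}$ of characteristic zero, $R=\mathbb{K}[x_0,x_1,x_2]$. For $Z=\{P_1,\dots,P_r\}$, $I(P_i)$ is the homogeneous maximal ideal of $P_i$ and $I(kZ)=I(P_1)^k\cap\dots\cap I(P_r)^k$ (the $k$-th symbolic power of $I(Z)$). For a homogeneous ideal $J$, $\alpha(J)=\min\{n:J_n\ne0\}$ is its initial degree. *)

(* Defs.v *)
From HB Require Import structures.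
From mathcomp Require Import all_boot all_order all_algebra.
From mathcomp Require Import mpoly.
Set Implicit Arguments. Unset Strict Implicit. Unset Printing Implicit Defensive.
Import GRing.Theory.
Local Open Scope ring_scope.

Section Defs.
Variable K : fieldType.

(* Homogeneous coordinates of a point of P^2 (meaningful when nonzero). *)
Definition coords := 'I_3 -> K.

Definition nonzero_pt (P : coords) : Prop := exists i, P i != 0.

Definition same_pt (P Q : coords) : Prop :=
  exists c : K, c != 0 /\ forall i, Q i = c * P i.

(* A linear form vanishing at P: element of I(P)_1.  I(P) is generated by
   these linear forms. *)
Definition lin_at (P : coords) (l : {mpoly K[3]}) : Prop :=
  l \is 1.-homog /\ l.@[P] = 0.

Definition in_Ipow (P : coords) (k : nat) (f : {mpoly K[3]}) : Prop :=
  exists (m : nat) (g : 'I_m -> {mpoly K[3]}) (L : 'I_m -> 'I_k -> {mpoly K[3]}),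
    (forall j i, lin_at P (L j i)) /\
    f = \sum_(j < m) g j * \prod_(i < k) L j i.

Definition in_IkZ (r : nat) (Z : 'I_r -> coords) (k : nat) (f : {mpoly K[3]}) : Prop :=
  forall s : 'I_r, in_Ipow (Z s) k f.

Definition is_alpha (J : {mpoly K[3]} -> Prop) (d : nat) : Prop :=
  (exists f, f != 0 /\ f \is d.-homog /\ J f) /\
  (forall n f, (n < d)%N -> f \is n.-homog -> J f -> f = 0).

Definition collinear (r : nat) (Z : 'I_r -> coords) : Prop :=
  exists l : {mpoly K[3]}, l != 0 /\ l \is 1.-homog /\ forall s, l.@[Z s] = 0.

Definition is_line (l : {mpoly K[3]}) : Prop := l != 0 /\ l \is 1.-homog.

Definition same_line (l l' : {mpoly K[3]}) : Prop :=
  exists c : K, c != 0 /\ l' = c *: l.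

Definition intersection_pt (m : nat) (L : 'I_m -> {mpoly K[3]}) (P : coords) : Prop :=
  exists i j, ~ same_line (L i) (L j) /\ (L i).@[P] = 0 /\ (L j).@[P] = 0.

Definition is_intersection_set (r : nat) (Z : 'I_r -> coords)
    (m : nat) (L : 'I_m -> {mpoly K[3]}) : Prop :=
  (forall i, is_line (L i)) /\
  (forall s, intersection_pt L (Z s)) /\
  (forall P, nonzero_pt P -> intersection_pt L P -> exists s, same_pt (Z s) P).

End Defs.

(* Main.v *)
Require Import Defs.
From HB Require Import structures.
From mathcomp Require Import all_boot all_order all_algebra.
From mathcomp Require Import mpoly.
From mathcomp Require Import perm polyXY zify ring.
From Stdlib Require Import Classical.
Set Implicit Arguments. Unset Strict Implicit. Unset Printing Implicit Defensive.
Import GRing.Theory.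
Local Open Scope ring_scope.

(** The idea: take a form [f] of degree [a + 1] in the ideal of [kZ].  If [C] is
    an irreducible factor of [f] of degree [d >= 2], with multiplicities [m_P] at
    the points [P] of [Z], then Bezout's inequality applied to [C] and to its
    derivative along a tangent direction at a further point of [C] gives
    [sum m_P (m_P - 1) < d (d - 1)].  By a dimension count there is then a form
    [H] of degree [d - 2] with multiplicity at least [m_P - 1] at each [P], and
    [f / C * H] has degree [a - 1] and lies in the ideal of [(k - 1)Z], which is
    impossible.  So [f] is a product of lines.  For the same reason two distinct
    lines [l, l'] of [f] meet at a point of [Z] lying on at most [k] of the lines:
    otherwise [f / (l l')] contradicts minimality.  If all lines of [f] through
    some point of [Z] agree with [l], then [l] occurs at least [k] times, so a
    line [l'] other than [l] would meet it at a point on more than [k] lines; hence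
    [f] is a power of [l] up to a scalar, and [Z] is contained in [l].

    A plane curve is given in an affine chart by an element of [{poly {poly K}}]
    with outer variable ['X] and inner variable ['Y]; a point [p] has coordinates
    ['X = p.1] and ['Y = p.2]. *)

(** * Weighted determinants and resultants *)

Section MultiplicativeFiltration.
Variable R : comNzRingType.

Definition multiplicative_filtration (Q : nat -> {pred R}) :=
  [/\ forall d, GRing.zmod_closed (Q d), 1 \in Q 0 &
      forall d e, {in Q d & Q e, forall a b, a * b \in Q (d + e)%N}].

(* The exponents [v] allow the entries of a column to lie deeper in the
   filtration than the weights [w] of the rows alone would grant. *)
Lemma det_filtration (Q : nat -> {pred R}) n (M : 'M[R]_n) (w v : 'I_n -> nat) x :
  multiplicative_filtration Q -> (forall i j, M i j * x ^+ v j \in Q (w i)) ->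
  \det M * x ^+ (\sum_i v i)%N \in Q (\sum_i w i)%N.
Proof.
case=> zmodQ Q1 QM QMij; have QD d : {in Q d &, forall a b, a + b \in Q d}.
  by have [_ ] := GRing.zmod_closedD (zmodQ d).
have [Q0 _] := zmodQ (\sum_i w i)%N.
rewrite /determinant big_distrl /=; apply: (big_ind (fun a => a \in Q _)) => // [a b|s _].
  exact: QD.
rewrite [X in x ^+ X](reindex_inj (@perm_inj _ s)) /= -prodrXr -mulrA -big_split /=.
have Qs : \prod_i (M i (s i) * x ^+ v (s i)) \in Q (\sum_i w i)%N.
  by apply: (big_ind2 (fun a d => a \in Q d)) => // a d b e; apply: QM.
rewrite mulr_sign; case: ifP => // _.
by have /(_ _ Qs) := GRing.zmod_closedN (zmodQ (\sum_i w i)%N).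
Qed.

End MultiplicativeFiltration.

Lemma size_filtration (R : comNzRingType) :
  multiplicative_filtration (fun d => [pred p : {poly R} | size p <= d.+1]%N).
Proof.
split=> [d||d e p q]; first split=> [|p q]; rewrite !inE ?size_poly0 ?size_poly1 // => sp sq.
  by rewrite (leq_trans (size_polyD _ _)) // geq_max size_polyN sp.
by apply: leq_trans (size_polyMleq _ _) _; move: sp sq; lia.
Qed.

Lemma dvdp_filtration (K : fieldType) (q : {poly K}) :
  multiplicative_filtration (fun d => [pred p | q ^+ d %| p]).
Proof.
split=> [d||d e p1 p2]; first split=> [|p1 p2]; rewrite !inE ?dvdp0 ?dvd1p //.
  exact: dvdp_sub.
by rewrite exprD; apply: dvdp_mul.
Qed.

Lemma size_det_weighted (R : idomainType) n (M : 'M[{poly R}]_n) (w v : 'I_n -> nat) d :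
  (forall i j, size (M i j * 'X^(v j))%R <= (w i).+1)%N ->
  (\sum_i w i <= d + \sum_i v i)%N -> (size (\det M) <= d.+1)%N.
Proof.
move=> sM le_d; have := det_filtration (size_filtration R) sM; rewrite inE.
have [->|nzM] := eqVneq (\det M) 0; first by rewrite size_poly0.
rewrite size_mulXn // => le_w; rewrite -(leq_add2l (\sum_i v i)) (leq_trans le_w) //.
by rewrite addnS ltnS addnC.
Qed.

Lemma dvdp_det_weighted (K : fieldType) (q : {poly K}) n (M : 'M[{poly K}]_n)
    (w v : 'I_n -> nat) d :
  q != 0 -> (forall i j, q ^+ w i %| M i j * q ^+ v j) ->
  (d + \sum_i v i <= \sum_i w i)%N -> q ^+ d %| \det M.
Proof.
move=> nzq dM le_d; have := det_filtration (dvdp_filtration q) dM; rewrite inE.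
move=> /(dvdp_trans (dvdp_exp2l q le_d)); rewrite exprD dvdp_mul2r //.
by rewrite expf_eq0 (negPf nzq) andbF.
Qed.

Lemma big_ord_split (R : Type) (idx : R) (op : Monoid.law idx) m n (F : 'I_m + 'I_n -> R) :
  \big[op/idx]_(i < m + n) F (split i) =
    op (\big[op/idx]_(i < m) F (inl i)) (\big[op/idx]_(i < n) F (inr i)).
Proof.
rewrite big_split_ord; congr (op _ _); apply: eq_bigr => i _.
  by rewrite -[lshift _ _]/(unsplit (inl i)) unsplitK.
by rewrite -[rshift _ _]/(unsplit (inr i)) unsplitK.
Qed.

Section ResultantTranslation.
Variable R : idomainType.
Implicit Types (p q : {poly R}) (a : R).

Definition shift_mx n a : 'M[R]_n := \matrix_(i < n) poly_rV (('X + a%:P) ^+ i).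

Lemma mul_shift_mx n a (v : 'rV[R]_n) :
  v *m shift_mx n a = poly_rV (rVpoly v \Po ('X + a%:P)).
Proof.
rewrite mulmx_sum_row /rVpoly poly_def !linear_sum /=.
by apply: eq_bigr => i _; rewrite rowK !linearZ /= comp_Xn_poly valK.
Qed.

Lemma size_XaddC_exp a n : size (('X + a%:P) ^+ n) = n.+1.
Proof. by rewrite -[a]opprK polyCN size_exp_XsubC. Qed.

Lemma det_shift_mx n a : \det (shift_mx n a) = 1.
Proof.
rewrite det_trig.
  rewrite big1 // => i _; rewrite !mxE.
  have /monicP := monic_exp i (monicXaddC a).
  by rewrite lead_coefE size_XaddC_exp.
by apply/is_trig_mxP => i j ltij; rewrite !mxE nth_default ?size_XaddC_exp.
Qed.

Definition band_mx d n p : 'M[R]_(d, n) := lin1_mx (poly_rV \o p \o* rVpoly).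

Lemma band_mx_shift d n p a : (size p + d <= n.+1)%N ->
  band_mx d n p *m shift_mx n a = shift_mx d a *m band_mx d n (p \Po ('X + a%:P)).
Proof.
move=> sp; apply/row_matrixP => i; rewrite !row_mul rowE !mul_rV_lin1 /=.
rewrite mul_shift_mx rowK rVpoly_delta !poly_rV_K ?rmorphM /= ?comp_Xn_poly //.
  by rewrite size_XaddC_exp.
rewrite (leq_trans (size_polyMleq _ _)) // size_polyXn.
by have := ltn_ord i; lia.
Qed.

Lemma resultant_comp_XaddC p q a :
  resultant (p \Po ('X + a%:P)) (q \Po ('X + a%:P)) = resultant p q.
Proof.
set X := 'X + a%:P; set m := (size p).-1; set n := (size q).-1.
have -> : resultant (p \Po X) (q \Po X) =
    \det (col_mx (band_mx n (n + m) (p \Po X)) (band_mx m (n + m) (q \Po X))).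
  by rewrite /m /n -(size_comp_poly2 p (size_XaddC a)) -(size_comp_poly2 q (size_XaddC a)).
have : Sylvester_mx p q *m shift_mx (n + m) a = block_mx (shift_mx n a) 0 0 (shift_mx m a)
    *m col_mx (band_mx n (n + m) (p \Po X)) (band_mx m (n + m) (q \Po X)).
  rewrite mul_col_mx mul_block_col !mul0mx addr0 add0r -!band_mx_shift ?mul_col_mx //;
    by rewrite /m /n; lia.
move/(congr1 (@determinant _ _)); rewrite !det_mulmx det_ublock !det_shift_mx.
by rewrite !mulr1 mul1r.
Qed.

End ResultantTranslation.

(** * Total degree of bivariate polynomials *)

Lemma coef_comp_polyCMX (R : comNzRingType) (p : {poly R}) c j :
  (p \Po (c%:P * 'X))`_j = p`_j * c ^+ j.
Proof.
rewrite coef_comp_poly; under eq_bigr => i _ do rewrite exprMn -polyC_exp coefCM coefXn.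
have [ltj|lej] := ltnP j (size p).
  rewrite (bigD1 (Ordinal ltj)) //= eqxx mulr1 big1 ?addr0 // => i.
  by rewrite -val_eqE eq_sym /= => /negPf->; rewrite !mulr0.
rewrite nth_default // mul0r big1 // => i _; rewrite gtn_eqF ?mulr0 //.
exact: leq_trans lej.
Qed.

Section TotalDegree.
Variable R : idomainType.
Local Notation bipoly := {poly {poly R}}.
Implicit Types (A B : bipoly) (p : {poly R}).

(* One plus the total degree, or [0] for the zero polynomial: replacing ['X]
   by ['Y * 'X] turns the total degree into the degree in ['Y]. *)
Definition tdsize A := sizeY (A \Po ('Y * 'X)).

Lemma tdsize_leP n A :
  reflect (forall j, A`_j != 0 -> (size (A`_j)%R + j <= n)%N) (tdsize A <= n)%N.
Proof.
have coefA j : (size ((A \Po ('Y * 'X))`_j)%R <= n)%N =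
    (A`_j != 0) ==> (size (A`_j)%R + j <= n)%N.
  rewrite coef_comp_polyCMX; have [->|nz] := eqVneq A`_j 0; first by rewrite mul0r size_poly0.
  by rewrite /= size_mulXn // addnC.
apply: (iffP idP) => [le_n j nz | le_n].
  have := leq_trans (max_size_coefXY (A \Po ('Y * 'X)) j) le_n.
  by rewrite coefA nz.
by apply/bigmax_leqP => j _; rewrite coefA; apply/implyP/le_n.
Qed.

Lemma tdsize_coef A j : A`_j != 0 -> (size (A`_j)%R + j <= tdsize A)%N.
Proof. exact: (tdsize_leP _ _ (leqnn _)). Qed.

Lemma tdsize_coef_eq0 n A i j : (tdsize A <= n.+1)%N -> (n < i + j)%N -> A`_i`_j = 0.
Proof.
move=> sA lt_n; have [->|nz] := eqVneq A`_i 0; first by rewrite coef0.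
rewrite nth_default // -(leq_add2r i) (leq_trans (tdsize_coef nz)) // (leq_trans sA) //.
by rewrite addnC.
Qed.

Lemma tdsize_eq0 A : (tdsize A == 0)%N = (A == 0).
Proof.
apply/idP/eqP => [|->]; last by rewrite sizeY_eq0 comp_poly0.
rewrite -leqn0 => /tdsize_leP A0; apply/polyP => j; rewrite coef0.
by apply/eqP/negP => /negP nz; have := A0 j nz; rewrite leqn0 addn_eq0 size_poly_eq0 (negPf nz).
Qed.

Lemma tdsize0 : tdsize 0 = 0%N.
Proof. by apply/eqP; rewrite tdsize_eq0. Qed.

Lemma tdsize_gt0 A : (0 < tdsize A)%N = (A != 0).
Proof. by rewrite lt0n tdsize_eq0. Qed.

Lemma tdsizeE A : tdsize A = size (swapXY (A \Po ('Y * 'X))).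
Proof. exact: sizeYE. Qed.

Lemma tdsizeM A B : A != 0 -> B != 0 -> tdsize (A * B) = (tdsize A + tdsize B).-1.
Proof.
rewrite -(tdsize_eq0 A) -(tdsize_eq0 B) !tdsizeE comp_polyM (rmorphM swapXY) !size_poly_eq0.
exact: size_mul.
Qed.

Lemma tdsizeD_leq A B n : (tdsize A <= n -> tdsize B <= n -> tdsize (A + B)%R <= n)%N.
Proof.
rewrite !tdsizeE comp_polyD (raddfD swapXY) => sA sB.
by rewrite (leq_trans (size_polyD _ _)) // geq_max sA.
Qed.

Lemma tdsize_sum_leq (I : Type) (r : seq I) (P : pred I) (F : I -> bipoly) n :
  (forall i, P i -> tdsize (F i) <= n)%N -> (tdsize (\sum_(i <- r | P i) F i)%R <= n)%N.
Proof.
move=> sF; apply: (big_ind (fun A => tdsize A <= n)%N) => [|A B|//].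
- by rewrite tdsize0.
- exact: tdsizeD_leq.
Qed.

Lemma tdsizeM_leq A B m n : (tdsize A <= m.+1)%N -> (tdsize B <= n.+1)%N ->
  (tdsize (A * B)%R <= (m + n).+1)%N.
Proof.
move=> sA sB; have [->|nzA] := eqVneq A 0; first by rewrite mul0r tdsize0.
have [->|nzB] := eqVneq B 0; first by rewrite mulr0 tdsize0.
by rewrite tdsizeM //; move: sA sB; lia.
Qed.

Lemma tdsizeC p : tdsize p%:P = size p.
Proof.
apply/eqP; rewrite eqn_leq; apply/andP; split.
  by apply/tdsize_leP => -[|j]; rewrite coefC ?eqxx //= addn0.
have [->|nz] := eqVneq p 0; first by rewrite size_poly0.
by have := @tdsize_coef p%:P 0; rewrite coefC addn0 => /(_ nz).
Qed.

Lemma tdsizeX_leq A n : (tdsize A <= 2)%N -> (tdsize (A ^+ n)%R <= n.+1)%N.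
Proof.
move=> sA; elim: n => [|n IHn]; first by rewrite tdsizeC size_poly1.
by rewrite exprS; apply: (@tdsizeM_leq _ _ 1 n).
Qed.

Lemma size_leq_tdsize A : (size A <= tdsize A)%N.
Proof.
have [->|nzA] := eqVneq A 0; first by rewrite size_poly0.
have := @tdsize_coef A (size A).-1; rewrite -lead_coefE lead_coef_eq0 => /(_ nzA).
have := size_poly_gt0 (lead_coef A); rewrite lead_coef_eq0 nzA.
have := size_poly_gt0 A; rewrite nzA; lia.
Qed.

Lemma tdsize_XaddC p : (size p <= 2)%N -> tdsize ('X + p%:P) = 2%N.
Proof.
move=> sp; apply/eqP; rewrite eqn_leq; have := size_leq_tdsize ('X + p%:P).
rewrite size_XaddC => ->; rewrite andbT.
apply/tdsize_leP => -[|[|j]]; rewrite coefD coefX coefC /= ?add0r ?addr0 ?addn0 //.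
  by rewrite size_poly1.
by rewrite eqxx.
Qed.

Lemma tdsize_leq1 A : (tdsize A <= 1)%N -> A = (A`_0`_0)%:P%:P.
Proof.
move=> sA; have eA := size1_polyC (leq_trans (size_leq_tdsize A) sA).
by rewrite {1}eA; congr (_%:P); apply: size1_polyC; rewrite -tdsizeC -eA.
Qed.

Definition shiftX (a : R) A := A \Po ('X + a%:P%:P).

Lemma size_shiftX a A : size (shiftX a A) = size A.
Proof. by rewrite size_comp_poly2 // size_XaddC. Qed.

Lemma shiftXK a : cancel (shiftX a) (shiftX (- a)).
Proof. by move=> A; rewrite /shiftX !polyCN comp_polyXaddC_K. Qed.

Lemma shiftX_taylor a A :
  A = \sum_(j < size (shiftX a A)) ((shiftX a A)`_j)%:P * ('X - a%:P%:P) ^+ j.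
Proof.
rewrite -{1}(shiftXK a A) {1}/shiftX comp_polyE !polyCN.
by apply: eq_bigr => j _; rewrite mul_polyC.
Qed.

Lemma shiftX_eq0 a A : (shiftX a A == 0) = (A == 0).
Proof. by rewrite comp_poly2_eq0 // size_XaddC. Qed.

Lemma tdsize_shiftX a A : (tdsize (shiftX a A) <= tdsize A)%N.
Proof.
rewrite /shiftX comp_polyE; apply: tdsize_sum_leq => i _; rewrite -mul_polyC.
have [->|nz] := eqVneq A`_i 0; first by rewrite mul0r tdsize0.
apply: leq_trans (tdsize_coef nz); rewrite -(prednK (_ : 0 < size (A`_i)%R)%N) ?size_poly_gt0 //.
apply: tdsizeM_leq; first by rewrite tdsizeC leqSpred.
by apply: tdsizeX_leq; rewrite tdsize_XaddC // (leq_trans (size_polyC_leq1 _)).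
Qed.

End TotalDegree.

(** * Multiplicity of a plane curve at a point *)

Section DivisibleCoefficients.
Variable K : fieldType.
Local Notation bipoly := {poly {poly K}}.
Implicit Types (A B : bipoly) (d : {poly K}) (a : K).

Definition coefs_dvd d A := all (dvdp d) A.

Lemma coefs_dvdP d A : reflect (exists B, A = d%:P * B) (coefs_dvd d A).
Proof.
apply: (iffP (all_nthP 0)) => [dA|[B ->] j _]; last by rewrite coefCM dvdp_mulr.
exists (\poly_(j < size A) (A`_j %/ d)); apply/polyP => j.
rewrite coefCM coef_poly; case: ltnP => [/dA dAj|leAj]; last by rewrite mulr0 nth_default.
by rewrite mulrC divpK.
Qed.

Lemma coefs_dvd_coefP d A : reflect (forall j, d %| A`_j) (coefs_dvd d A).
Proof.
apply: (iffP (all_nthP 0)) => dA j; last by [].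
by have [/dA //|le] := ltnP j (size A); rewrite nth_default ?dvdp0.
Qed.

Lemma coefs_dvd_mulCl d A : coefs_dvd d (d%:P * A).
Proof. by apply/coefs_dvdP; exists A. Qed.

Lemma coefs_dvd_mul2l c d A : c != 0 -> coefs_dvd (c * d) (c%:P * A) = coefs_dvd d A.
Proof.
by move=> nzc; apply/coefs_dvd_coefP/coefs_dvd_coefP => dA j; have := dA j;
  rewrite coefCM dvdp_mul2l.
Qed.

Lemma coefs_dvd_XsubC a A : coefs_dvd ('X - a%:P) A = (map_poly (horner_eval a) A == 0).
Proof.
apply/coefs_dvd_coefP/eqP => [dA|A0 j].
  by apply/polyP => j; have := dA j; rewrite coef_map coef0 dvdp_XsubCl => /eqP.
by have := congr1 (fun q : {poly K} => q`_j) A0; rewrite coef0 coef_map dvdp_XsubCl => /eqP.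
Qed.

Lemma coefs_dvd_XsubC_mul a A B :
  coefs_dvd ('X - a%:P) (A * B) = coefs_dvd ('X - a%:P) A || coefs_dvd ('X - a%:P) B.
Proof. by rewrite !coefs_dvd_XsubC rmorphM mulf_eq0. Qed.

Lemma coefs_dvd_XsubC_exp_cancel a k A B : ~~ coefs_dvd ('X - a%:P) A ->
  coefs_dvd (('X - a%:P) ^+ k) (A * B) -> coefs_dvd (('X - a%:P) ^+ k) B.
Proof.
move=> ndA; elim: k B => [|k IHk] B; first by move=> _; apply/coefs_dvd_coefP => j; apply: dvd1p.
move=> dAB; have : coefs_dvd ('X - a%:P) (A * B).
  apply/coefs_dvd_coefP => j; move/coefs_dvd_coefP/(_ j): dAB.
  by apply: dvdp_trans; rewrite exprS dvdp_mulr.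
rewrite coefs_dvd_XsubC_mul (negPf ndA) /= => /coefs_dvdP[B' eB].
move: dAB; rewrite eB mulrCA exprS !coefs_dvd_mul2l ?polyXsubC_eq0 //.
exact: IHk.
Qed.

End DivisibleCoefficients.

Lemma horner_comp_eval (R : comNzRingType) (A : {poly {poly R}}) (r : {poly R}) y :
  A.[r].[y] = (map_poly (horner_eval y) A).[r.[y]].
Proof. by rewrite -[LHS]horner_evalE -horner_map. Qed.

Section Multiplicity.
Variable K : fieldType.
Local Notation bipoly := {poly {poly K}}.
Implicit Types (A B : bipoly) (p : K * K) (a : K).

Definition blowup p A := A \Po (('X - p.2%:P)%:P * 'X + p.1%:P%:P).

(* The multiplicity is the order of vanishing along the exceptional line of the
   blow-up chart [(x, y) -> (p.1 + (y - p.2) x, y)], which makes it a valuation. *)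
Definition mult_ge p k A := coefs_dvd (('X - p.2%:P) ^+ k) (blowup p A).

Lemma blowupM p A B : blowup p (A * B) = blowup p A * blowup p B.
Proof. exact: rmorphM. Qed.

Lemma coef_blowup p A j : (blowup p A)`_j = (shiftX p.1 A)`_j * ('X - p.2%:P) ^+ j.
Proof.
by rewrite -coef_comp_polyCMX /shiftX -comp_polyA comp_polyD comp_polyX comp_polyC.
Qed.

Lemma mult_geP p k A :
  reflect (forall j, ('X - p.2%:P) ^+ (k - j) %| (shiftX p.1 A)`_j) (mult_ge p k A).
Proof.
apply: (iffP (coefs_dvd_coefP _ _)) => dA j; have := dA j; rewrite coef_blowup.
  have [lekj|ltjk] := leqP k j; first by move/eqP: lekj => ->; rewrite dvd1p.
  by rewrite -{1}(subnK (ltnW ltjk)) exprD dvdp_mul2r ?expf_neq0 ?polyXsubC_eq0.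
have [lekj _|ltjk dj] := leqP k j; first by rewrite dvdp_mull // dvdp_exp2l.
by rewrite -(subnK (ltnW ltjk)) exprD dvdp_mul.
Qed.

Lemma mult_ge_coef p k A j e : mult_ge p k A -> (e <= k - j)%N ->
  ('X - p.2%:P) ^+ e %| (shiftX p.1 A)`_j.
Proof. by move=> /mult_geP kA lee; apply: dvdp_trans (kA j); apply: dvdp_exp2l. Qed.

Lemma mult_ge1 p A : mult_ge p 1 A = (A.[p.1, p.2] == 0).
Proof.
rewrite /mult_ge expr1 coefs_dvd_XsubC map_comp_poly rmorphD rmorphM /= !map_polyC /=.
rewrite !horner_evalE hornerXsubC subrr mul0r add0r comp_polyCr polyC_eq0.
by rewrite horner_comp_eval !hornerC.
Qed.

Lemma mult_ge0 p A : mult_ge p 0 A.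
Proof. by apply/mult_geP => j; apply: dvd1p. Qed.

Lemma mult_ge_poly0 p k : mult_ge p k 0.
Proof. by apply/mult_geP => j; rewrite /shiftX comp_poly0 coef0 dvdp0. Qed.

Lemma mult_ge_leq p k l A : (l <= k)%N -> mult_ge p k A -> mult_ge p l A.
Proof. by move=> lelk kA; apply/mult_geP => j; apply: mult_ge_coef kA _; lia. Qed.

Lemma mult_geD p k A B : mult_ge p k A -> mult_ge p k B -> mult_ge p k (A + B).
Proof.
move=> /mult_geP kA /mult_geP kB; apply/mult_geP => j.
by rewrite /shiftX comp_polyD coefD dvdp_add.
Qed.

Lemma mult_geM p k l A B :
  mult_ge p k A -> mult_ge p l B -> mult_ge p (k + l) (A * B).
Proof.
rewrite /mult_ge blowupM exprD => /coefs_dvdP[A' ->] /coefs_dvdP[B' ->].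
by rewrite mulrACA -polyCM coefs_dvd_mulCl.
Qed.

Lemma mult_ge_mull p k A B : mult_ge p k B -> mult_ge p k (A * B).
Proof. exact: mult_geM (mult_ge0 p A). Qed.

Lemma mult_ge_prod p (ls : seq bipoly) :
  mult_ge p (count (mult_ge p 1) ls) (\prod_(l <- ls) l).
Proof.
elim: ls => [|l ls IHls]; first by rewrite big_nil mult_ge0.
rewrite big_cons /=; apply: mult_geM => //.
by case: (boolP (mult_ge p 1 l)) => // _; apply: mult_ge0.
Qed.

Lemma mult_ge_cancel p m k A B : mult_ge p m A -> ~~ mult_ge p m.+1 A ->
  mult_ge p k (A * B) -> mult_ge p (k - m) B.
Proof.
have nz n : ('X - p.2%:P) ^+ n != 0 by rewrite expf_neq0 ?polyXsubC_eq0.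
have [lekm _ _ _|/ltnW lemk] := leqP k m.
  by move: lekm; rewrite -subn_eq0 => /eqP ->; apply: mult_ge0.
rewrite /mult_ge blowupM => /coefs_dvdP[A' ->]; rewrite exprSr coefs_dvd_mul2l // => nA'.
by rewrite -mulrA -{1}(subnKC lemk) exprD coefs_dvd_mul2l //; apply: coefs_dvd_XsubC_exp_cancel.
Qed.

Lemma mult_ge_ltn_tdsize p k A : A != 0 -> mult_ge p k A -> (k < tdsize A)%N.
Proof.
move=> nzA /mult_geP/(_ (size A).-1); set c := _`_(size A).-1 => dc.
have nzc : c != 0 by rewrite /c -(size_shiftX p.1 A) -lead_coefE lead_coef_eq0 shiftX_eq0.
have := dvdp_leq nzc dc; rewrite size_exp_XsubC.
have := leq_trans (tdsize_coef nzc) (tdsize_shiftX p.1 A).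
by rewrite -/c; move: (size c) (size A).-1 (tdsize A) => n j d; lia.
Qed.

Lemma multiplicity_exists A : A != 0 ->
  exists m : K * K -> nat, forall p, mult_ge p (m p) A && ~~ mult_ge p (m p).+1 A.
Proof.
move=> nzA; have unbounded p : exists n, ~~ mult_ge p n.+1 A.
  by exists (tdsize A); apply/negP => /(mult_ge_ltn_tdsize nzA); lia.
exists (fun p => ex_minn (unbounded p)) => p.
case: ex_minnP => -[|m] -> min_m; rewrite andbT; first exact: mult_ge0.
by apply: contraTT isT => /min_m; rewrite ltnn.
Qed.

End Multiplicity.

(** * Directional derivatives *)

Section DirectionalDerivative.
Variable K : fieldType.
Local Notation bipoly := {poly {poly K}}.
Implicit Types (A B : bipoly) (p v : K * K) (r : {poly K}).

Definition derivY A : bipoly := map_poly (@deriv K) A.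

Definition dirderiv v A := v.1%:P%:P * A^`() + v.2%:P%:P * derivY A.

Lemma coef_derivY A j : (derivY A)`_j = (A`_j)^`().
Proof. by rewrite coef_map_id0 ?deriv0. Qed.

Lemma derivYD A B : derivY (A + B) = derivY A + derivY B.
Proof. by apply/polyP => j; rewrite !(coef_derivY, coefD, derivD). Qed.

Lemma derivYM A B : derivY (A * B) = derivY A * B + A * derivY B.
Proof.
apply/polyP => j; rewrite coef_derivY coefD !coefM raddf_sum -big_split /=.
by apply: eq_bigr => i _; rewrite derivM !coef_derivY.
Qed.

Lemma derivYC r : derivY r%:P = (r^`())%:P.
Proof. by apply/polyP => j; rewrite coef_derivY !coefC; case: eqP; rewrite ?deriv0. Qed.

Lemma derivY_X : derivY 'X = 0.
Proof.
by apply/polyP => j; rewrite coef_derivY coefX coef0 -polyC_natr derivC.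
Qed.

Lemma deriv_horner A r : A.[r]^`() = (derivY A).[r] + A^`().[r] * r^`().
Proof.
elim/poly_ind: A => [|A c IHA].
  by rewrite /derivY map_poly0 !deriv0 !horner0 deriv0 mul0r addr0.
rewrite derivYD derivYM derivYC derivY_X mulr0 addr0 !derivD !derivM derivC !derivX addr0 mulr1.
by rewrite !hornerE derivD derivM IHA; ring.
Qed.

Lemma shiftX_derivY (a : K) A : shiftX a (derivY A) = derivY (shiftX a A).
Proof.
rewrite /shiftX; elim/poly_ind: A => [|A c IHA]; first by rewrite /derivY !(map_poly0, comp_poly0).
rewrite derivYD derivYM derivYC derivY_X mulr0 addr0.
rewrite !comp_poly_MXaddC derivYD derivYM derivYC IHA derivYD derivY_X derivYC derivC.
by rewrite polyC0 addr0 mulr0 addr0.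
Qed.

Lemma shiftX_deriv (a : K) A : shiftX a A^`() = (shiftX a A)^`().
Proof. by rewrite /shiftX deriv_comp derivD derivX derivC addr0 mulr1. Qed.

Lemma dvdp_XsubC_exp_deriv (a : K) k r :
  ('X - a%:P) ^+ k %| r -> ('X - a%:P) ^+ k.-1 %| r^`().
Proof.
case: k => [|k]; first by rewrite expr0 !dvd1p.
case/dvdpP => h ->; rewrite derivM dvdp_add //.
  by rewrite dvdp_mull // dvdp_exp2l.
by rewrite deriv_exp derivXsubC mul1r -mulr_natl !dvdp_mull.
Qed.

Lemma mult_ge_dirderiv p k v A : mult_ge p k A -> mult_ge p k.-1 (dirderiv v A).
Proof.
move=> kA; apply: mult_geD; apply: mult_ge_mull; apply/mult_geP => j.
  rewrite shiftX_deriv coef_deriv -mulr_natl dvdp_mull //.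
  by apply: mult_ge_coef kA _; lia.
have -> : (k.-1 - j = (k - j).-1)%N by lia.
by rewrite shiftX_derivY coef_derivY dvdp_XsubC_exp_deriv // (mult_ge_coef kA).
Qed.

Lemma tdsize_deriv A : (tdsize A^`() <= (tdsize A).-1)%N.
Proof.
apply/tdsize_leP => j; rewrite coef_deriv => nz.
have nzA : A`_j.+1 != 0 by apply: contraNneq nz => ->; rewrite mul0rn.
have := tdsize_coef nzA; have := size_scale_leq j.+1%:R A`_j.+1; rewrite scaler_nat.
by move: (size _) (size _) (tdsize A); lia.
Qed.

Lemma tdsize_derivY A : (tdsize (derivY A) <= (tdsize A).-1)%N.
Proof.
apply/tdsize_leP => j; rewrite coef_derivY => nz.
have nzA : A`_j != 0 by apply: contraNneq nz => ->; rewrite deriv0.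
have := tdsize_coef nzA; have := lt_size_deriv nzA.
by move: (size _) (size _) (tdsize A); lia.
Qed.

Lemma tdsize_dirderiv v A : (tdsize (dirderiv v A) <= (tdsize A).-1)%N.
Proof.
have scale (c : K) B n : (tdsize B <= n -> tdsize (c%:P%:P * B)%R <= n)%N.
  case: n => [|n]; first by rewrite leqn0 tdsize_eq0 => /eqP->; rewrite mulr0 tdsize0.
  by move=> sB; apply: (@tdsizeM_leq _ _ _ 0 n); rewrite // tdsizeC size_polyC_leq1.
by apply: tdsizeD_leq; apply: scale; [apply: tdsize_deriv | apply: tdsize_derivY].
Qed.

End DirectionalDerivative.

(** * Bezout's inequality *)

Lemma size_prod_XsubC_exp (R : idomainType) (I : Type) (s : seq I) (a : I -> R) (e : I -> nat) :
  size (\prod_(i <- s) ('X - (a i)%:P) ^+ e i) = (\sum_(i <- s) e i).+1.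
Proof.
elim: s => [|i s IHs]; first by rewrite !big_nil size_poly1.
rewrite !big_cons size_Mmonic ?expf_neq0 ?polyXsubC_eq0 //.
  by rewrite size_exp_XsubC IHs addSn /= addnS.
by apply: monic_prod => j _; apply/monic_exp/monicXsubC.
Qed.

Lemma dvdp_prod_XsubC_exp (K : fieldType) (I : eqType) (s : seq I) (a : I -> K)
    (e : I -> nat) (q : {poly K}) : uniq (map a s) ->
  {in s, forall i, ('X - (a i)%:P) ^+ e i %| q} ->
  \prod_(i <- s) ('X - (a i)%:P) ^+ e i %| q.
Proof.
elim: s => [|i s IHs] /=; first by rewrite big_nil dvd1p.
case/andP=> ais us dq; rewrite big_cons Gauss_dvdp; last first.
  rewrite coprimep_expl // big_seq; apply: (big_ind (coprimep _)) => [|p1 p2|j js].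
  - exact: coprimep1.
  - by rewrite coprimepMr => -> ->.
  apply: coprimep_expr; rewrite coprimep_XsubC root_XsubC.
  by apply: contra ais => /eqP <-; apply: map_f.
rewrite dq ?mem_head // IHs // => j js.
by apply: dq; rewrite inE js orbT.
Qed.

Lemma leq_sum_mult_weights (c e m n : nat) : (m <= c)%N ->
  (m * n + \sum_(j < e + c) minn j (m + n) <=
   \sum_(k < e) (m + minn k n) + \sum_(k < c) (n + minn k m))%N.
Proof.
move=> /subnKC <-; elim: (c - m)%N => [|c' IHc]; last first.
  rewrite !addnS !big_ord_recr /=; move: IHc.
  set s1 := (\sum_(j < e + (m + c')) _)%N; set s2 := (\sum_(k < e) _)%N.
  by set s3 := (\sum_(k < m + c') _)%N; lia.
rewrite addn0 (addnC e) big_split_ord /= addnA addnC leq_add //.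
  by apply: leq_sum => k _; lia.
rewrite big_split /= sum_nat_const card_ord leq_add2l leq_sum // => k _.
by have := ltn_ord k; lia.
Qed.

Lemma leq_sum_degree_weights (c e c' e' : nat) : (c' <= c)%N -> (e' <= e)%N ->
  (\sum_(k < e') (c + k) + \sum_(k < c') (e + k) <=
   c * e + \sum_(j < e' + c') j)%N.
Proof.
move=> lec lee; rewrite big_split_ord /= !big_split /= !sum_nat_const !card_ord.
have := leq_mul lec (leqnn (e - e')).
set s1 := (\sum_(k < e') _)%N; set s2 := (\sum_(k < c') _)%N; nia.
Qed.

Section Bezout.
Variable K : fieldType.
Local Notation bipoly := {poly {poly K}}.
Implicit Types (A C G : bipoly) (p : K * K).

Lemma dvdp_resultant p m n C G : (m <= (size C).-1)%N ->
  mult_ge p m C -> mult_ge p n G -> ('X - p.2%:P) ^+ (m * n) %| resultant C G.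
Proof.
rewrite -(size_shiftX p.1 C) -(resultant_comp_XaddC C G p.1%:P) => le_m mC nG.
have entry A l l' (k j : nat) : mult_ge p l A ->
    ('X - p.2%:P) ^+ (l + minn k l') %|
      (shiftX p.1 A)`_(j - k) *+ (k <= j)%N * ('X - p.2%:P) ^+ minn j (l + l').
  move=> lA; have [lekj|_] := leqP k j; last by rewrite mul0r dvdp0.
  have le_l : (l + minn k l' <= l - (j - k) + minn j (l + l'))%N by move: lekj; clear; lia.
  apply: dvdp_trans (dvdp_exp2l _ le_l) _; rewrite mulr1n exprD.
  by apply: dvdp_mul (dvdpp _); apply: mult_ge_coef lA _.
pose w (t : 'I_(size (shiftX p.1 G)).-1 + 'I_(size (shiftX p.1 C)).-1) :=
  match t with inl k => m + minn k n | inr k => n + minn k m end%N.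
apply: (@dvdp_det_weighted _ _ _ _ (fun i => w (split i)) (fun j => minn j (m + n))).
- by rewrite polyXsubC_eq0.
- move=> i j; rewrite Sylvester_mxE /w; case: (split i) => k; first exact: entry.
  by rewrite [(m + n)%N]addnC; apply: entry.
by rewrite big_ord_split; apply: leq_sum_mult_weights.
Qed.

Lemma size_resultant_leq c e C G : (tdsize C <= c.+1)%N -> (tdsize G <= e.+1)%N ->
  (size (resultant C G) <= (c * e).+1)%N.
Proof.
move=> sC sG; set c' := (size C).-1; set e' := (size G).-1.
have lec : (c' <= c)%N by rewrite /c' -subn1 leq_subLR (leq_trans (size_leq_tdsize C)).
have lee : (e' <= e)%N by rewrite /e' -subn1 leq_subLR (leq_trans (size_leq_tdsize G)).
pose w (t : 'I_e' + 'I_c') := match t with inl k => c + k | inr k => e + k end%N.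
apply: (@size_det_weighted _ _ _ (fun i => w (split i)) (fun j => j : nat)).
- have entry A d (k : nat) (j : nat) : (tdsize A <= d.+1)%N ->
      (size (A`_(j - k) *+ (k <= j)%N * 'X^j)%R <= (d + k).+1)%N.
    move=> sA; have [lekj|_] := leqP k j; last by rewrite mul0r size_poly0.
    rewrite mulr1n; have [->|nz] := eqVneq A`_(j - k) 0; first by rewrite mul0r size_poly0.
    by rewrite size_mulXn //; have := tdsize_coef nz; move: sA; move: (size _) (tdsize A); lia.
  by move=> i j; rewrite Sylvester_mxE /w; case: (split i) => k; apply: entry.
by rewrite big_ord_split; apply: leq_sum_degree_weights.
Qed.

Lemma bezout_multiplicities c e C G (s : seq (K * K)) (m n : K * K -> nat) :
  (tdsize C <= c.+1)%N -> (tdsize G <= e.+1)%N -> resultant C G != 0 ->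
  uniq (map snd s) -> {in s, forall p, m p <= (size C).-1}%N ->
  {in s, forall p, mult_ge p (m p) C} -> {in s, forall p, mult_ge p (n p) G} ->
  (\sum_(p <- s) m p * n p <= c * e)%N.
Proof.
move=> sC sG nzR us le_m mC nG; rewrite -ltnS -(size_prod_XsubC_exp s snd).
apply: leq_trans (size_resultant_leq sC sG); apply: dvdp_leq nzR _.
by apply: dvdp_prod_XsubC_exp us _ => p ps; apply: dvdp_resultant; auto.
Qed.

End Bezout.

(** * Interpolation by counting conditions *)

Lemma linear_system_nonzero_solution (K : fieldType) (I J : finType) (A : I -> J -> K) :
  (#|J| < #|I|)%N ->
  exists2 v : I -> K, exists i, v i != 0 & forall j, \sum_i v i * A i j = 0.
Proof.
move=> ltJI; pose M := \matrix_(i < #|I|, j < #|J|) A (enum_val i) (enum_val j).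
have /rowV0Pn[v /sub_kermxP vM /rV0Pn[i0 nz]] : kermx M != 0.
  by rewrite -mxrank_eq0 mxrank_ker; have := rank_leq_col M; lia.
exists (fun i => v 0 (enum_rank i)); first by exists (enum_val i0); rewrite enum_valK.
move=> j; have /rowP/(_ (enum_rank j)) := vM; rewrite !mxE => {2}<-.
rewrite (reindex (@enum_val I predT)) /=; last first.
  by exists enum_rank => i _; rewrite ?enum_valK ?enum_rankK.
by apply: eq_bigr => i _; rewrite mxE enum_valK enum_rankK.
Qed.

Section Interpolation.
Variable K : fieldType.
Local Notation bipoly := {poly {poly K}}.
Implicit Types (A : bipoly) (p : K * K).

(* The exponents [(j, i)] of the monomials ['X^j * 'Y^i] of total degree less than [d]. *)
Definition triangle d := {j : 'I_d & 'I_(d - j)}.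

Lemma card_triangle d : (#|{: triangle d}| * 2 = d * d.+1)%N.
Proof.
rewrite card_tagged sumnE big_map big_enum /=.
under eq_bigr => j _ do rewrite card_ord.
have -> : (\sum_(j < d) (d - j) = \sum_(j < d) j.+1)%N.
  by rewrite (reindex_inj rev_ord_inj); apply: eq_bigr => j _ /=; have := ltn_ord j; lia.
elim: d => [|d IHd]; first by rewrite big_ord0.
by rewrite big_ord_recr /= mulnDl IHd; lia.
Qed.

Definition triangle_monomial d (t : triangle d) : bipoly := ('X^(tagged t))%:P * 'X^(tag t).

Definition triangle_poly d (v : triangle d -> K) : bipoly :=
  \sum_t (v t)%:P%:P * triangle_monomial t.

Lemma coef_triangle_poly d v (t : triangle d) : (triangle_poly v)`_(tag t)`_(tagged t) = v t.
Proof.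
rewrite !coef_sum (bigD1 t) //= big1 ?addr0 => [|u ne_u].
  by rewrite !coefCM coefXn eqxx mulr1 coefXn eqxx mulr1.
rewrite !coefCM coefXn; case: eqP => [ej|]; last by rewrite mulr0 coef0 mulr0.
rewrite mulr1 coefXn; case: eqP => [ei|]; last by rewrite mulr0.
case/eqP: ne_u; case: t u ej ei => [j i] [j' i'] /= /val_inj ej.
by subst j' => /val_inj ->.
Qed.

Lemma tdsize_triangle_poly d (v : triangle d -> K) : (tdsize (triangle_poly v) <= d)%N.
Proof.
apply: tdsize_sum_leq => t _; apply/tdsize_leP => j; rewrite !coefCM coefXn.
have [-> _|_] := eqVneq j (tag t); last by rewrite !mulr0 eqxx.
rewrite mulr1 mul_polyC; apply: leq_trans (leq_add (size_scale_leq _ _) (leqnn _)) _.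
by rewrite size_polyXn addSn addnC -ltn_subRL.
Qed.

Definition jet_coef p k j l A : K :=
  ((shiftX p.1 A)`_j %% ('X - p.2%:P) ^+ (k - j))`_l.

Lemma jet_coef_sum p k j l (I : finType) (v : I -> K) (A : I -> bipoly) :
  jet_coef p k j l (\sum_i (v i)%:P%:P * A i) = \sum_i v i * jet_coef p k j l (A i).
Proof.
rewrite /jet_coef /shiftX rmorph_sum coef_sum /= (big_morph _ (modpD _) (mod0p _)) coef_sum.
apply: eq_bigr => i _.
by rewrite rmorphM /= comp_polyC coefCM mul_polyC modpZl coefZ.
Qed.

Lemma mult_ge_jet_coef p k A :
  (forall t : triangle k, jet_coef p k (tag t) (tagged t) A = 0) -> mult_ge p k A.
Proof.
move=> jA; apply/mult_geP => j; have [ltjk|] := ltnP j k; last first.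
  by rewrite -subn_eq0 => /eqP ->; rewrite dvd1p.
apply/modp_eq0P/polyP => l; rewrite coef0; have [ltl|lel] := ltnP l (k - j).
  exact: (jA (Tagged (fun j : 'I_k => 'I_(k - j)) (Ordinal ltl : 'I_(k - Ordinal ltjk)))).
have := ltn_modp (shiftX p.1 A)`_j (('X - p.2%:P) ^+ (k - j)).
rewrite expf_neq0 ?polyXsubC_eq0 // size_exp_XsubC ltnS => /leq_trans/(_ lel).
exact: nth_default.
Qed.

Lemma interpolation_exists (s : seq (K * K)) (n : K * K -> nat) d :
  (\sum_(p <- s) n p * (n p).+1 < d * d.+1)%N ->
  exists H : bipoly, [/\ H != 0, (tdsize H <= d)%N &
    {in s, forall p, mult_ge p (n p) H}].
Proof.
move=> lt_d; pose pt (i : 'I_(size s)) := tnth (in_tuple s) i.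
pose J := {i : 'I_(size s) & triangle (n (pt i))}.
pose jet (c : J) A :=
  jet_coef (pt (tag c)) (n (pt (tag c))) (tag (tagged c)) (tagged (tagged c)) A.
have ltJ : (#|{: J}| < #|{: triangle d}|)%N.
  rewrite -(ltn_pmul2r (isT : 0 < 2)%N) card_triangle; apply: leq_ltn_trans lt_d.
  rewrite card_tagged sumnE big_map big_enum /= big_distrl /= [X in (_ <= X)%N]big_tnth.
  by apply: leq_sum => i _; rewrite card_triangle.
have [v [t nz_v] vJ] := linear_system_nonzero_solution
  (fun (t : triangle d) (c : J) => jet c (triangle_monomial t)) ltJ.
exists (triangle_poly v); split; last 1 first.
- move=> p /(tnthP (in_tuple s))[i ->]; apply: mult_ge_jet_coef => c.
  by rewrite jet_coef_sum; apply: (vJ (Tagged (fun i => triangle (n (pt i))) c)).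
- by apply: contraNneq nz_v => v0; rewrite -coef_triangle_poly v0 !coef0.
- exact: tdsize_triangle_poly.
Qed.

End Interpolation.

(** * Irreducible plane curves *)

Section CommonFactors.
Variable K : closedFieldType.
Local Notation bipoly := {poly {poly K}}.
Implicit Types (A B C G : bipoly) (d : {poly K}).

Lemma gauss_factorization d A B Q : d != 0 -> d%:P * A = B * Q ->
  exists d1 d2 B' Q', [/\ B = d1%:P * B', Q = d2%:P * Q' & A = B' * Q'].
Proof.
elim: {d}_.+1 {-2}d (ltnSn (size d)) A B Q => // n IHn d; rewrite ltnS => le_dn A B Q nzd eA.
have [/size_poly1P[c nzc ed]|/closed_rootP[a /factor_theorem[d' ed]]] := boolP (size d == 1%N).
  exists 1, d, B, (c^-1%:P%:P * Q); rewrite mul1r ed mulrA -polyCM -polyCM divff // mul1r.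
  by split=> //; rewrite mulrCA -eA ed mulrA -!polyCM mulVf // mul1r.
have nzd' : d' != 0 by apply: contraNneq nzd => d0; rewrite ed d0 mul0r.
have lt_d' : (size d' < n)%N.
  by apply: leq_trans le_dn; rewrite ed size_Mmonic ?monicXsubC // size_XsubC addn2.
have nza : ('X - a%:P)%:P != 0 :> bipoly by rewrite polyC_eq0 polyXsubC_eq0.
have {}eA : ('X - a%:P)%:P * (d'%:P * A) = B * Q by rewrite mulrA -polyCM [_ * d']mulrC -ed.
have := coefs_dvd_mulCl ('X - a%:P) (d'%:P * A).
rewrite eA coefs_dvd_XsubC_mul => /orP[] /coefs_dvdP[C eC].
  have [|d1 [d2 [B' [Q' [eB eQ ->]]]]] := IHn _ lt_d' A C Q nzd'.
    by apply: (mulfI nza); rewrite eA eC mulrA.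
  by exists (('X - a%:P) * d1), d2, B', Q'; split; rewrite // eC eB polyCM mulrA.
have [|d1 [d2 [B' [Q' [eB eQ ->]]]]] := IHn _ lt_d' A B C nzd'.
  by apply: (mulfI nza); rewrite eA eC mulrCA.
by exists d1, (('X - a%:P) * d2), B', Q'; split; rewrite // eC eQ polyCM mulrA.
Qed.

Lemma resultant_eq0_common_factor C G : resultant C G = 0 ->
  exists D C' G', [/\ C = D * C', G = D * G' & (1 < size D)%N].
Proof.
move/eqP; rewrite resultant_eq0.
have := dvdp_gcdl C G; have := dvdp_gcdr C G; move: (gcdp C G) => D.
move=> /Pdiv.Idomain.dvdpP[[e G1] /= nze]; rewrite -mul_polyC mulrC [G1 * D]mulrC => eG.
move=> /Pdiv.Idomain.dvdpP[[d C1] /= nzd]; rewrite -mul_polyC [C1 * D]mulrC => eC ltD.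
have size_gt1 (d0 : {poly K}) B : (1 < size (d0%:P * B)%R)%N -> (1 < size B)%N.
  by rewrite mul_polyC => /leq_trans; apply; apply: size_scale_leq.
have [d1 [_ [D1 [C2 [eD _ eC']]]]] := gauss_factorization nzd eC.
have : e%:P * G = D1 * (d1%:P * G1) by rewrite mulrC eG eD mulrCA mulrA.
case/(gauss_factorization nze) => d2 [_ [D2 [G2 [eD1 _ eG']]]].
exists D2, (d2%:P * C2), G2; split; rewrite // ?eC' ?eD1; first by rewrite mulrCA mulrA.
by apply: (size_gt1 d2); rewrite -eD1; apply: (size_gt1 d1); rewrite -eD.
Qed.

End CommonFactors.

Lemma deriv_eq0_pchar0 (R : idomainType) (q : {poly R}) :
  [pchar R] =i pred0 -> q^`() = 0 -> q = (q`_0)%:P.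
Proof.
move=> char0 q0; apply/polyP => -[|j]; rewrite coefC //=.
have := congr1 (fun q : {poly R} => q`_j) q0; rewrite coef_deriv coef0 -mulr_natl => /eqP.
by rewrite mulf_eq0; have /pcharf0P -> := char0; move/eqP.
Qed.

Section IrreducibleCurves.
Variable K : closedFieldType.
Local Notation bipoly := {poly {poly K}}.
Implicit Types (A B C G : bipoly) (p v : K * K).

Definition bipoly_irreducible C :=
  forall A B, C = A * B -> (tdsize A <= 1)%N \/ (tdsize B <= 1)%N.

Lemma irreducible_factor_tdsize C A B : C != 0 -> bipoly_irreducible C -> C = A * B ->
  (1 < tdsize A)%N -> tdsize A = tdsize C.
Proof.
move=> nzC irrC eC ltA; move: (nzC); rewrite eC mulf_eq0 negb_or => /andP[nzA nzB].
rewrite tdsizeM //; move: nzB; rewrite -tdsize_gt0.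
by case: (irrC _ _ eC); move: ltA; move: (tdsize A) (tdsize B) => m n; lia.
Qed.

Lemma irreducible_resultant_neq0 C G : bipoly_irreducible C -> G != 0 ->
  (tdsize G < tdsize C)%N -> resultant C G != 0.
Proof.
move=> irrC nzG ltGC; apply/eqP => /resultant_eq0_common_factor[D [C' [G' [eC eG ltD]]]].
have nzC : C != 0 by rewrite -tdsize_gt0 (leq_ltn_trans _ ltGC).
have eD := irreducible_factor_tdsize nzC irrC eC (leq_trans ltD (size_leq_tdsize D)).
move: (nzG) ltGC; rewrite eG mulf_eq0 negb_or => /andP[nzD nzG'].
rewrite tdsizeM // -eD; move: nzG'; rewrite -tdsize_gt0.
by move: (tdsize D) (tdsize G') => m n; lia.
Qed.

Variable C : bipoly.
Hypotheses (irrC : bipoly_irreducible C) (degC : (2 < tdsize C)%N).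

Lemma irreducible_neq0 : C != 0.
Proof. by rewrite -tdsize_gt0 (ltn_trans _ degC). Qed.

Lemma irreducible_no_linear_factor A B : tdsize A = 2 -> C != A * B.
Proof.
move=> sA; apply/eqP => eC; have := irreducible_factor_tdsize irreducible_neq0 irrC eC.
by rewrite sA => /(_ isT) e; move: degC; rewrite -e.
Qed.

Lemma irreducible_ncoefs_dvd a : ~~ coefs_dvd ('X - a%:P) C.
Proof.
apply/coefs_dvdP => -[B]; apply/eqP/irreducible_no_linear_factor.
by rewrite tdsizeC size_XsubC.
Qed.

Lemma irreducible_horner_neq0 (r : {poly K}) : (size r <= 2)%N -> C.[r] != 0.
Proof.
move=> sr; apply/negP => /factor_theorem[B]; rewrite mulrC; apply/eqP.
by apply: irreducible_no_linear_factor; rewrite -polyCN tdsize_XaddC ?size_polyN.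
Qed.

Lemma irreducible_size : (1 < size C)%N.
Proof.
rewrite ltnNge; apply/negP => /size1_polyC eC.
have /closed_rootP[a ra] : size C`_0 != 1%N.
  by rewrite -tdsizeC -eC; apply: contraTneq degC => ->.
have /negP[] := irreducible_ncoefs_dvd a; apply/coefs_dvd_coefP => j.
by rewrite eC coefC; case: eqP => _; rewrite ?dvdp0 ?dvdp_XsubCl.
Qed.

Lemma irreducible_mult_leq p m : mult_ge p m C -> (m <= (size C).-1)%N.
Proof.
move=> mC; rewrite leqNgt; apply: contra (irreducible_ncoefs_dvd p.2) => ltm.
have /coefs_dvdP[B eB] : coefs_dvd ('X - p.2%:P) (shiftX p.1 C).
  apply/(all_nthP 0) => j; rewrite size_shiftX -[X in X %| _]expr1 => ltj.
  by apply: mult_ge_coef mC _; move: (size C) ltm ltj => n; lia.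
rewrite -(shiftXK p.1 C) eB /shiftX comp_polyM comp_polyC.
exact: coefs_dvd_mulCl.
Qed.

Lemma irreducible_point_exists (s : seq K) : exists2 P : K * K, P.2 \notin s & mult_ge P 1 C.
Proof.
have /closed_nonrootP[y] : lead_coef C * \prod_(a <- s) ('X - a%:P) != 0.
  by rewrite mulf_neq0 ?lead_coef_eq0 ?irreducible_neq0 // monic_neq0 ?monic_prod_XsubC.
rewrite rootM negb_or root_prod_XsubC => /andP[nzy ys].
have /closed_rootP[x rx] : size (map_poly (horner_eval y) C) != 1%N.
  by rewrite size_map_poly_id0 // gtn_eqF // irreducible_size.
by exists (x, y); rewrite // mult_ge1 /= horner_comp_eval hornerC.
Qed.

Hypothesis char0 : [pchar K] =i pred0.

(* Along the line through [P] in the direction [v] the polynomial [C] has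
   derivative [dirderiv v C]; if this vanished, [C] would contain the line. *)
Lemma irreducible_dirderiv_neq0 P v : mult_ge P 1 C -> v != (0, 0) -> dirderiv v C != 0.
Proof.
rewrite mult_ge1 => /eqP CP nzv; apply/eqP => dvC.
have [v2|nzv2] := eqVneq v.2 0.
  have nzv1 : v.1 != 0 by apply: contraNneq nzv => v1; rewrite [v]surjective_pairing v1 v2.
  have : C^`() = 0.
    move: dvC; rewrite /dirderiv v2 mul0r addr0 => /eqP.
    by rewrite mulf_eq0 !polyC_eq0 (negPf nzv1) => /eqP.
  have charP : [pchar {poly K}] =i pred0 by move=> n; rewrite pchar_poly.
  move/(deriv_eq0_pchar0 charP) => eC; have := irreducible_size.
  by rewrite eC ltnNge size_polyC_leq1.
pose r := (v.1 / v.2) *: ('X - P.2%:P) + P.1%:P.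
have rP : r.[P.2] = P.1 by rewrite /r !hornerE subrr mulr0 add0r.
have sr : (size r <= 2)%N.
  rewrite (leq_trans (size_polyD _ _)) // geq_max (leq_trans (size_polyC_leq1 _)) // andbT.
  by rewrite (leq_trans (size_scale_leq _ _)) ?size_XsubC.
have : v.2%:P * C.[r]^`() = (dirderiv v C).[r].
  rewrite deriv_horner hornerD !hornerCM /r derivD derivZ derivXsubC derivC addr0 -mul_polyC.
  by rewrite mulr1 mulrDr addrC mulrCA -polyCM [v.2 * _]mulrC divfK // [_ * v.1%:P]mulrC.
rewrite dvC horner0 => /eqP; rewrite mulf_eq0 polyC_eq0 (negPf nzv2) /= => /eqP.
move/(deriv_eq0_pchar0 char0) => eCr; have /eqP[] := irreducible_horner_neq0 sr.
have : C.[r].[P.2] = 0 by rewrite horner_comp_eval rP -CP horner_comp_eval hornerC.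
by rewrite eCr hornerC => ->.
Qed.

Lemma polar_exists P : mult_ge P 1 C ->
  exists G, [/\ G != 0, (tdsize G <= (tdsize C).-1)%N,
    forall p m, mult_ge p m C -> mult_ge p m.-1 G & mult_ge P 1 G].
Proof.
move=> CP; pose grad := (C^`().[P.1, P.2], (derivY C).[P.1, P.2]).
have [v nzv tangent] : exists2 v : K * K, v != (0, 0) & v.1 * grad.1 + v.2 * grad.2 = 0.
  have [->|nz] := eqVneq grad (0, 0).
    by exists (0, 1); rewrite ?mulr0 ?addr0 // xpair_eqE oner_eq0 andbF.
  exists (- grad.2, grad.1); last by rewrite /=; ring.
  by apply: contraNneq nz => -[/eqP]; rewrite oppr_eq0 /grad => /eqP-> ->.
exists (dirderiv v C); split.
- exact: irreducible_dirderiv_neq0 CP nzv.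
- exact: tdsize_dirderiv.
- by move=> p m; apply: mult_ge_dirderiv.
by rewrite mult_ge1 !(hornerD, hornerCM) tangent.
Qed.

(* The genus bound in the form [sum m (m - 1) < d (d - 1)]: the curve [C] and its
   tangent polar at an extra point [P] meet once more, at [P]. *)
Lemma sum_mult_ltn (s : seq (K * K)) (m : K * K -> nat) : uniq (map snd s) ->
  (forall p, mult_ge p (m p) C) ->
  (\sum_(p <- s) m p * (m p).-1 < (tdsize C).-1 * (tdsize C).-2)%N.
Proof.
move=> us mC; have [P Ps PC] := irreducible_point_exists (map snd s).
have [G [nzG sG mG PG]] := polar_exists PC.
have [c cE] : exists c, tdsize C = c.+3 by exists (tdsize C - 3)%N; move: degC; lia.
have nzR : resultant C G != 0.
  by apply: irreducible_resultant_neq0 => //; apply: leq_ltn_trans sG _; rewrite cE.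
pose m' p := if p == P then 1%N else m p.
pose n' p := if p == P then 1%N else (m p).-1.
have sP p : p \in s -> (p == P) = false.
  by move=> ps; apply: contraNF Ps => /eqP <-; apply: map_f.
have : (\sum_(p <- P :: s) m' p * n' p <= c.+2 * c.+1)%N.
  apply: (bezout_multiplicities _ _ nzR); rewrite /= ?Ps ?us ?cE //.
  - by move: sG; rewrite cE.
  - by move=> p _; rewrite /m'; case: eqP => _; [have := irreducible_size; case: size => [|[]]
      | apply: irreducible_mult_leq].
  - by move=> p _; rewrite /m'; case: eqP => [->|].
  by move=> p _; rewrite /n'; case: eqP => [->|_]; last apply: mG.
rewrite cE big_cons /m' /n' eqxx [X in (_ + X)%N]big_seq.
by under eq_bigr => p ps do rewrite sP //; rewrite -big_seq.
Qed.

(* Stands in for the adjoint curves of [C]: the degree drops by two, the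
   multiplicities only by one. *)
Lemma adjoint_exists (s : seq (K * K)) (m : K * K -> nat) : uniq (map snd s) ->
  (forall p, mult_ge p (m p) C) ->
  exists H, [/\ H != 0, (tdsize H <= (tdsize C).-2)%N &
    {in s, forall p, mult_ge p (m p).-1 H}].
Proof.
move=> us mC; apply: interpolation_exists; have := sum_mult_ltn us mC.
have -> : (\sum_(p <- s) m p * (m p).-1 = \sum_(p <- s) (m p).-1 * (m p).-1.+1)%N.
  by apply: eq_bigr => p _; case: (m p) => [|k] //=; rewrite mulnC.
by case: (tdsize C) degC => [|[|n]] //=; rewrite mulnC.
Qed.

End IrreducibleCurves.

(** * Line arrangements in the affine plane *)

Lemma sub_in_count (T : eqType) (P Q : pred T) (s : seq T) :
  {in s, forall x, P x -> Q x} -> (count P s <= count Q s)%N.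
Proof.
move=> PQ; rewrite -(eq_in_count (a1 := predI P Q)) => [|x xs /=].
  by apply: sub_count => x /= /andP[].
by apply: andb_idr => /(PQ x xs).
Qed.

Lemma perm_to_rem2 (T : eqType) (x y : T) (s : seq T) : x \in s -> y \in s -> x != y ->
  perm_eq s [:: x, y & rem y (rem x s)].
Proof.
move=> xs ys ne; apply: perm_trans (perm_to_rem xs) _; rewrite perm_cons perm_to_rem //.
by move: ys; rewrite (perm_mem (perm_to_rem xs)) inE eq_sym (negPf ne).
Qed.

Section ProductsOfLines.
Variable K : fieldType.
Local Notation bipoly := {poly {poly K}}.
Implicit Types (l : bipoly) (p : K * K) (ls : seq bipoly).

Definition affine_line l := tdsize l == 2.

Lemma affine_line_neq0 l : affine_line l -> l != 0.
Proof. by move=> /eqP sl; rewrite -tdsize_gt0 sl. Qed.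

Lemma tdsize_prod_lines ls : all affine_line ls -> tdsize (\prod_(l <- ls) l) = (size ls).+1.
Proof.
elim: ls => [|l ls IHls] /=; first by rewrite big_nil tdsizeC size_poly1.
case/andP=> line_l /IHls sls; rewrite big_cons tdsizeM ?(affine_line_neq0 line_l) //.
  by rewrite sls (eqP line_l).
by rewrite -tdsize_gt0 sls.
Qed.

Lemma mult_prod_lines p ls k (c : K) : c != 0 -> all affine_line ls ->
  mult_ge p k (c%:P%:P * \prod_(l <- ls) l) -> (k <= count (mult_ge p 1) ls)%N.
Proof.
move=> nzc; elim: ls k => [|l ls IHls] k /=.
  rewrite big_nil mulr1 => _ /mult_ge_ltn_tdsize.
  by rewrite !polyC_eq0 tdsizeC size_polyC nzc => /(_ isT).
case/andP=> line_l line_ls; rewrite big_cons mulrCA => kl.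
have [pl|npl] := boolP (mult_ge p 1 l); last first.
  by have := IHls _ line_ls (mult_ge_cancel (mult_ge0 p l) npl kl); rewrite subn0.
have nl2 : ~~ mult_ge p 2 l.
  by apply/negP => /(mult_ge_ltn_tdsize (affine_line_neq0 line_l)); rewrite (eqP line_l).
by rewrite -leq_subLR (IHls _ line_ls (mult_ge_cancel pl nl2 kl)).
Qed.

Definition proportional l l' := exists2 c : K, c != 0 & l' = c%:P%:P * l.

Lemma proportional_refl l : proportional l l.
Proof. by exists 1; rewrite ?oner_eq0 ?mul1r. Qed.

Lemma mult_ge1_proportional p l l' : proportional l l' -> mult_ge p 1 l' = mult_ge p 1 l.
Proof.
by case=> c nzc ->; rewrite !mult_ge1 !hornerCM mulf_eq0 (negPf nzc).
Qed.

End ProductsOfLines.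

Prenex Implicits affine_line.

Definition extremal_curve (K : fieldType) (s : seq (K * K)) (k a : nat) (f : {poly {poly K}}) :=
  [/\ tdsize f = a.+2, {in s, forall p, mult_ge p k f} &
      forall g, (tdsize g <= a)%N -> {in s, forall p, mult_ge p k.-1 g} -> g = 0].

Lemma extremal_curve_neq0 (K : fieldType) s k a (f : {poly {poly K}}) :
  extremal_curve s k a f -> f != 0.
Proof. by case=> sf _ _; rewrite -tdsize_gt0 sf. Qed.

Section LinesOfExtremalCurve.
Variable K : fieldType.
Local Notation bipoly := {poly {poly K}}.
Implicit Types (l : bipoly) (p q : K * K).

Variables (s : seq (K * K)) (k a : nat) (f : bipoly).
Hypothesis extremal_f : extremal_curve s k a f.
Variables (c : K) (ls : seq bipoly).
Hypotheses (c_neq0 : c != 0) (f_ls : f = c%:P%:P * \prod_(l <- ls) l).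
Hypothesis line_ls : all affine_line ls.

Lemma size_extremal_lines : size ls = a.+1.
Proof.
have [tdsize_f _ _] := extremal_f.
have : tdsize f = (size ls).+1.
  rewrite f_ls tdsizeM ?tdsize_prod_lines ?tdsizeC ?size_polyC ?c_neq0 ?polyC_eq0 //.
  by rewrite -tdsize_gt0 tdsize_prod_lines.
by rewrite tdsize_f => -[].
Qed.

Lemma leq_count_extremal_lines p : p \in s -> (k <= count (mult_ge p 1) ls)%N.
Proof.
have [_ mult_f _] := extremal_f.
by move=> /mult_f; rewrite f_ls => /mult_prod_lines; apply.
Qed.

Lemma low_multiplicity_point_exists r : all affine_line r -> (size r < a)%N ->
  exists2 p, p \in s & (count (mult_ge p 1) r < k.-1)%N.
Proof.
move=> line_r lt_r; have sr := tdsize_prod_lines line_r.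
have [/hasP //|/hasPn high_r] := boolP (has (fun p => count (mult_ge p 1) r < k.-1)%N s).
suff r0 : \prod_(l <- r) l = 0 by move: sr; rewrite r0 tdsize0.
have [_ _ minimal] := extremal_f; apply: minimal => [|p ps]; first by rewrite sr.
by apply: mult_ge_leq (mult_ge_prod p r); rewrite leqNgt high_r.
Qed.

Lemma extremal_lines_meet l l' : l \in ls -> l' \in ls -> l != l' ->
  exists p, [/\ p \in s, mult_ge p 1 l, mult_ge p 1 l' & (count (mult_ge p 1) ls <= k)%N].
Proof.
move=> l_in l'_in ne; have perm_ls := perm_to_rem2 l_in l'_in ne.
set r := rem l' (rem l ls) in perm_ls.
have line_r : all affine_line r.
  by have := line_ls; rewrite (perm_all _ perm_ls) /= => /and3P[].
have [|p ps lt_r] := low_multiplicity_point_exists line_r.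
  by have := perm_size perm_ls; rewrite size_extremal_lines => -[->].
exists p; have := leq_count_extremal_lines ps.
have /seq.permP/(_ (mult_ge p 1)) /= -> := perm_ls; rewrite ps.
move: (count _ r) (mult_ge p 1 l) (mult_ge p 1 l') (k) lt_r; clear => n b b' k lt_n le_k.
by split; move: b b' lt_n le_k => [] []; lia.
Qed.

(* If all lines of [f] through a point [p] of [s] are proportional to [l] while
   [l'] is not, then [l] and [l'] meet in a point on more than [k] lines. *)
Lemma extremal_lines_through p : (0 < k)%N -> p \in s ->
  (exists l l', [/\ l \in ls, l' \in ls, mult_ge p 1 l, mult_ge p 1 l' & ~ proportional l l']) \/
  (exists2 l, l \in ls & {in s, forall q, mult_ge q 1 l}).
Proof.
move=> k_gt0 ps; have le_p := leq_count_extremal_lines ps.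
have on_some q : q \in s -> exists2 l, l \in ls & mult_ge q 1 l.
  by move=> /leq_count_extremal_lines le_q; apply/hasP; rewrite has_count (leq_trans k_gt0).
case: (classic (exists l l',
  [/\ l \in ls, l' \in ls, mult_ge p 1 l, mult_ge p 1 l' & ~ proportional l l'])).
  by left.
move=> nopair; right; have [l l_in pl] := on_some _ ps; exists l => // q qs.
have par l' : l' \in ls -> mult_ge p 1 l' -> proportional l l'.
  by move=> l'_in pl'; apply: NNPP => npar; case: nopair; exists l, l'.
have [l' l'_in ql'] := on_some _ qs.
case: (classic (proportional l l')) => [/(mult_ge1_proportional q) <- //|npar].
have [|t [ts tl tl' le_t]] := extremal_lines_meet l_in l'_in.
  by apply/eqP => e; apply: npar; rewrite e; apply: proportional_refl.
have npl' : mult_ge p 1 l' = false by apply/negP => /(par _ l'_in).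
suff : (count (mult_ge p 1) ls < count (mult_ge t 1) ls)%N by rewrite ltnNge (leq_trans le_t).
have /seq.permP perm_ls := perm_to_rem l'_in; rewrite !perm_ls /= npl' tl' ltnS.
apply: sub_in_count => m /mem_rem m_in pm.
by rewrite (mult_ge1_proportional t (par _ m_in pm)).
Qed.

End LinesOfExtremalCurve.

Section FactorsOfExtremalCurve.
Variable K : closedFieldType.
Hypothesis char0 : [pchar K] =i pred0.
Local Notation bipoly := {poly {poly K}}.
Implicit Types (A B C g h l : bipoly).

Variables (s : seq (K * K)) (k a : nat) (f : bipoly).
Hypothesis uniq_s : uniq (map snd s).
Hypothesis extremal_f : extremal_curve s k a f.

Lemma extremal_factor_neq0 g h : f = g * h -> (g != 0) && (h != 0).
Proof. by move=> ef; rewrite -negb_or -mulf_eq0 -ef (extremal_curve_neq0 extremal_f). Qed.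

Lemma extremal_irreducible_factor_leq2 C h : f = C * h -> bipoly_irreducible C -> (tdsize C <= 2)%N.
Proof.
move=> ef irrC; rewrite leqNgt; apply/negP => degC.
have /andP[nzC nzh] := extremal_factor_neq0 ef.
have [m mC] := multiplicity_exists nzC; have mC1 p : mult_ge p (m p) C by have /andP[] := mC p.
have [H [nzH sH mH]] := adjoint_exists irrC degC char0 uniq_s mC1.
have [tdsize_f mult_f minimal] := extremal_f.
have /eqP : H * h = 0; last by rewrite mulf_eq0 (negPf nzH) (negPf nzh).
apply: minimal => [|p ps].
  move: tdsize_f (nzh); rewrite ef !tdsizeM // -tdsize_gt0; move: degC sH.
  by move: (tdsize C) (tdsize H) (tdsize h) => x y z; lia.
have /andP[_ nmC] := mC p; have := mult_f _ ps; rewrite ef => /(mult_ge_cancel (mC1 p) nmC) mh.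
by apply: mult_ge_leq (mult_geM (mH p ps) mh); lia.
Qed.

Lemma extremal_factor_prod_lines g h : f = g * h ->
  exists (c : K) ls, g = c%:P%:P * \prod_(l <- ls) l /\ all affine_line ls.
Proof.
elim: {g}_.+1 {-2}g (ltnSn (tdsize g)) h => // n IHn g; rewrite ltnS => le_gn h ef.
have [le1|gt1] := leqP (tdsize g) 1.
  by exists g`_0`_0, [::]; rewrite big_nil mulr1 -tdsize_leq1.
have [le2|gt2] := leqP (tdsize g) 2.
  by exists 1, [:: g]; rewrite big_seq1 mul1r /= /affine_line eqn_leq le2 gt1.
have [A [B [eg gtA gtB]]] : exists A B, [/\ g = A * B, (1 < tdsize A)%N & (1 < tdsize B)%N].
  apply: NNPP => nAB; move: gt2; rewrite ltnNge (extremal_irreducible_factor_leq2 ef) // => A B eg.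
  have [le|gtA] := leqP (tdsize A) 1; [by left | right].
  by rewrite leqNgt; apply/negP => gtB; case: nAB; exists A, B.
have [ltA ltB] : (tdsize A < n)%N /\ (tdsize B < n)%N.
  have := extremal_factor_neq0 ef; rewrite eg mulf_eq0 negb_or => /andP[/andP[nzA nzB] _].
  move: le_gn; rewrite eg tdsizeM //; move: gtA gtB.
  by move: (tdsize A) (tdsize B) => x y; lia.
have [|cA [lA [eA lineA]]] := IHn A ltA (B * h); first by rewrite ef eg mulrA.
have [|cB [lB [eB lineB]]] := IHn B ltB (A * h); first by rewrite ef eg mulrCA mulrA.
exists (cA * cB), (lA ++ lB); rewrite all_cat lineA lineB big_cat /= !polyCM eg eA eB.
by split=> //; rewrite mulrACA.
Qed.

Lemma extremal_prod_lines : exists (c : K) ls,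
  [/\ c != 0, f = c%:P%:P * \prod_(l <- ls) l & all affine_line ls].
Proof.
have [|c [ls [ef line_ls]]] := @extremal_factor_prod_lines f 1; first by rewrite mulr1.
exists c, ls; split=> //; apply: contraNneq (extremal_curve_neq0 extremal_f) => c0.
by rewrite ef c0 !polyC0 mul0r.
Qed.

End FactorsOfExtremalCurve.

Theorem affine_arrangement (K : closedFieldType) (s : seq (K * K)) (k a : nat)
    (f : {poly {poly K}}) :
  [pchar K] =i pred0 -> uniq (map snd s) -> (0 < k)%N -> extremal_curve s k a f ->
  exists ls, all affine_line ls /\
  ((exists2 l, l \in ls & {in s, forall p, mult_ge p 1 l}) \/
   {in s, forall p, exists l l',
      [/\ l \in ls, l' \in ls, mult_ge p 1 l, mult_ge p 1 l' & ~ proportional l l']} /\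
   {in ls &, forall l l', ~ proportional l l' ->
      exists p, [/\ p \in s, mult_ge p 1 l & mult_ge p 1 l']}).
Proof.
move=> char0 us k_gt0 extremal_f.
have [c [ls [nzc ef line_ls]]] := extremal_prod_lines char0 us extremal_f.
exists ls; split=> //.
case: (classic (exists2 l, l \in ls & {in s, forall p, mult_ge p 1 l})); first by left.
move=> ncol; right; split=> [p ps|l l' l_in l'_in npar].
  by case: (extremal_lines_through extremal_f nzc ef line_ls k_gt0 ps).
have [|p [ps pl pl' _]] := extremal_lines_meet extremal_f nzc ef line_ls l_in l'_in.
  by apply/eqP => e; apply: npar; rewrite e; apply: proportional_refl.
by exists p.
Qed.

(** * Linear changes of coordinates *)

Lemma dhomogXU (R : nzRingType) n (i : 'I_n) : ('X_i : {mpoly R[n]}) \is 1.-homog.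
Proof. by rewrite dhomogX; apply/eqP/mdeg1. Qed.

Lemma dhomog1_exp (R : comNzRingType) n k (l : {mpoly R[n]}) :
  l \is 1.-homog -> l ^+ k \is k.-homog.
Proof. by move=> /(@dhomogMn _ _ _ _ _ k); rewrite mul1n. Qed.

Section LinearSubstitution.
Variables (R : comNzRingType) (n : nat).
Implicit Types (f : {mpoly R[n]}) (N M : 'M[R]_n) (P : 'I_n -> R).

Definition lin_act N P : 'I_n -> R := fun i => \sum_j N i j * P j.

Definition lin_subst N : {rmorphism {mpoly R[n]} -> {mpoly R[n]}} :=
  comp_mpoly [tuple \sum_j N i j *: 'X_j | i < n].

Lemma lin_substZ N c f : lin_subst N (c *: f) = c *: lin_subst N f.
Proof. exact: comp_mpolyZ. Qed.

Lemma meval_lin_subst N f P : (lin_subst N f).@[P] = f.@[lin_act N P].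
Proof.
rewrite comp_mpoly_meval; apply: meval_eq => i; rewrite tnth_mktuple raddf_sum.
by apply: eq_bigr => j _; rewrite /= mevalZ mevalXU.
Qed.

Lemma lin_subst_homog N d f : f \is d.-homog -> lin_subst N f \is d.-homog.
Proof.
move=> /dhomogP hf; rewrite /= comp_mpolyE big_seq; apply: rpred_sum => m /hf dm.
have {dm} <- : mdeg m = d := dm.
rewrite dhomogZ // mdegE; apply: (big_ind2 (fun f d => f \is d.-homog)).
- exact: dhomog1.
- by move=> f1 d1 f2 d2; apply: dhomogM.
move=> i _; apply: dhomog1_exp; rewrite tnth_mktuple rpred_sum // => j _.
by rewrite dhomogZ ?dhomogXU.
Qed.

Lemma sum_scale_mxK (V : lmodType R) N M (v : 'I_n -> V) i : M *m N = 1%:M ->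
  \sum_j M i j *: \sum_k N j k *: v k = v i.
Proof.
move=> MN; transitivity (\sum_k (M *m N) i k *: v k).
  under [RHS]eq_bigr => k _ do rewrite mxE scaler_suml.
  rewrite exchange_big; apply: eq_bigr => j _; rewrite scaler_sumr.
  by apply: eq_bigr => k _; rewrite scalerA.
rewrite MN (bigD1 i) //= big1 ?addr0 => [|k]; rewrite mxE ?eqxx ?scale1r // eq_sym => /negPf->.
by rewrite scale0r.
Qed.

Lemma lin_substK N M : N *m M = 1%:M -> cancel (lin_subst N) (lin_subst M).
Proof.
move=> NM f; have -> : lin_subst N f = \sum_(m <- msupp f) f@_m *: lin_subst N 'X_[m].
  exact: comp_mpolyEX.
rewrite {3}(mpolyE f) rmorph_sum; apply: eq_bigr => m _; rewrite lin_substZ /= comp_mpolyX.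
rewrite rmorph_prod mpolyXE_id; congr (_ *: _); apply: eq_bigr => i _.
rewrite rmorphXn tnth_mktuple rmorph_sum; congr (_ ^+ _).
rewrite -[RHS](sum_scale_mxK (fun i => 'X_i : {mpoly R[n]}) i NM).
by apply: eq_bigr => j _; rewrite lin_substZ /= comp_mpolyXU -tnth_nth tnth_mktuple.
Qed.

Lemma lin_actK N M P : M *m N = 1%:M -> lin_act M (lin_act N P) =1 P.
Proof. by move=> MN i; apply: (@sum_scale_mxK R^o). Qed.

End LinearSubstitution.

Section ProjectiveInvariance.
Variables (K : fieldType) (N : 'M[K]_3).
Local Notation form := {mpoly K[3]}.
Implicit Types (f l : form) (P Q : coords K).

Lemma in_Ipow_lin_subst (M : 'M[K]_3) P Q k f : lin_act M P =1 Q -> in_Ipow Q k f ->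
  in_Ipow P k (lin_subst M f).
Proof.
move=> MP [m [g [L [atQ ->]]]].
exists m, (lin_subst M \o g), (fun j i => lin_subst M (L j i)); split=> [j i|].
  have [hL LQ] := atQ j i; split; first exact: lin_subst_homog.
  by rewrite meval_lin_subst -LQ; apply: meval_eq.
by rewrite rmorph_sum; apply: eq_bigr => j _; rewrite rmorphM rmorph_prod.
Qed.

Lemma lin_subst_eq0 (M : 'M[K]_3) f : M \in unitmx -> (lin_subst M f == 0) = (f == 0).
Proof.
move=> M_unit; rewrite -{1}(raddf0 (lin_subst M)).
exact: inj_eq (can_inj (lin_substK (mulmxV M_unit))) _ _.
Qed.

Hypothesis N_unit : N \in unitmx.

Lemma is_alpha_lin_act r (Z : 'I_r -> coords K) k d :
  is_alpha (in_IkZ Z k) d -> is_alpha (in_IkZ (fun s => lin_act N (Z s)) k) d.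
Proof.
case=> [[f [nzf [hf If]]] min_d]; split=> [|n g lt_nd hg Ig].
  exists (lin_subst (invmx N) f); split; last split; last 1 first.
  - by move=> s; apply: in_Ipow_lin_subst (If s) => i; apply/lin_actK/mulVmx.
  - by rewrite lin_subst_eq0 ?unitmx_inv.
  exact: lin_subst_homog.
apply/eqP; rewrite -(lin_subst_eq0 g N_unit); apply/eqP.
by apply: (min_d n) => // [|s]; [apply: lin_subst_homog | apply: in_Ipow_lin_subst (Ig s)].
Qed.

Lemma is_line_lin_subst l : is_line l -> is_line (lin_subst N l).
Proof. by case=> nzl hl; split; [rewrite lin_subst_eq0 | apply: lin_subst_homog]. Qed.

Lemma same_line_lin_subst l l' : same_line (lin_subst N l) (lin_subst N l') -> same_line l l'.
Proof.
case=> c [nzc e]; exists c; split=> //.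
by apply: (can_inj (lin_substK (mulmxV N_unit))); rewrite lin_substZ.
Qed.

Lemma nonzero_pt_lin_act P : nonzero_pt P -> nonzero_pt (lin_act N P).
Proof.
move=> [i nzPi]; apply/existsP; apply: contraNT nzPi => /existsPn NP0.
rewrite -(lin_actK P (mulVmx N_unit)) {1}/lin_act big1 // => j _.
by have := NP0 j; rewrite negbK => /eqP->; rewrite mulr0.
Qed.

Lemma collinear_lin_act r (Z : 'I_r -> coords K) :
  collinear (fun s => lin_act N (Z s)) -> collinear Z.
Proof.
case=> l [nzl [hl lZ]]; exists (lin_subst N l); split; first by rewrite lin_subst_eq0.
by split=> [|s]; [apply: lin_subst_homog | rewrite meval_lin_subst].
Qed.

Lemma is_intersection_set_lin_act r (Z : 'I_r -> coords K) m (L : 'I_m -> form) :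
  is_intersection_set (fun s => lin_act N (Z s)) L ->
  is_intersection_set Z (lin_subst N \o L).
Proof.
have meet P : intersection_pt (lin_subst N \o L) P -> intersection_pt L (lin_act N P).
  case=> i [j [nsame [LP L'P]]]; exists i, j; rewrite -!meval_lin_subst; split=> // -[c [nzc e]].
  by apply: nsame; exists c; rewrite /= e lin_substZ.
move=> [lines [onL meetZ]]; split=> [i|]; first exact: is_line_lin_subst.
split=> [s|P nzP /meet meetP].
  have [i [j [nsame [LP L'P]]]] := onL s; exists i, j; rewrite /= !meval_lin_subst.
  by split=> // /same_line_lin_subst.
have [s [c [nzc e]]] := meetZ _ (nonzero_pt_lin_act nzP) meetP; exists s, c; split=> // i.
rewrite -(lin_actK P (mulVmx N_unit)) -[Z s i](lin_actK (Z s) (mulVmx N_unit)) mulr_sumr.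
by apply: eq_bigr => j _; rewrite e mulrCA.
Qed.

End ProjectiveInvariance.

(** * Homogeneous ideals of points and the affine chart *)

Section IdealPowers.
Variables (K : fieldType) (P : coords K).
Implicit Types (f g l : {mpoly K[3]}).

Lemma in_Ipow0 f : in_Ipow P 0 f.
Proof.
exists 1%N, (fun=> f), (fun _ _ => 0); split=> [j []//|].
by rewrite big_ord1 big_ord0 mulr1.
Qed.

Lemma in_Ipow_poly0 k : in_Ipow P k 0.
Proof.
exists 0%N, (fun=> 0), (fun _ _ => 0); split=> [[]//|].
by rewrite big_ord0.
Qed.

Lemma in_IpowD k f g : in_Ipow P k f -> in_Ipow P k g -> in_Ipow P k (f + g).
Proof.
case=> m1 [g1 [L1 [h1 ->]]] [m2 [g2 [L2 [h2 ->]]]].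
pose G t := match t with inl i => g1 i | inr i => g2 i end.
pose L t := match t with inl i => L1 i | inr i => L2 i end.
exists (m1 + m2)%N, (G \o split), (L \o split); split=> [j|]; first by rewrite /=; case: (split j).
by rewrite (big_ord_split _ (fun t => G t * \prod_(i < k) L t i)).
Qed.

Lemma in_Ipow_mul_lin_at k l f : lin_at P l -> in_Ipow P k f -> in_Ipow P k.+1 (l * f).
Proof.
move=> hl [m [g [L [hL ->]]]].
exists m, g, (fun j i => if unlift ord0 i is Some i' then L j i' else l); split.
  by move=> j i; case: unliftP.
rewrite mulr_sumr; apply: eq_bigr => j _; rewrite big_ord_recl unlift_none mulrCA.
by congr (_ * (_ * _)); apply: eq_bigr => i _; rewrite liftK.
Qed.

Lemma in_Ipow_mul_lin_at_exp k t l f :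
  lin_at P l -> in_Ipow P k f -> in_Ipow P (t + k) (l ^+ t * f).
Proof.
move=> hl hf; elim: t => [|t IHt]; first by rewrite mul1r.
by rewrite addSn exprS -mulrA; apply: in_Ipow_mul_lin_at.
Qed.

Lemma in_Ipow_leq k t f : (t <= k)%N -> in_Ipow P k f -> in_Ipow P t f.
Proof.
move=> /subnK <-; elim: (k - t)%N => // n IHn [m [g [L [hL fE]]]]; apply: IHn.
exists m, (fun j => g j * L j ord0), (fun j i => L j (lift ord0 i)); split=> //.
by rewrite fE; apply: eq_bigr => j _; rewrite big_ord_recl mulrA.
Qed.

End IdealPowers.

Lemma big_ord3 (R : Type) (idx : R) (op : Monoid.law idx) (F : 'I_3 -> R) :
  \big[op/idx]_(i < 3) F i = op (F 0) (op (F 1) (F 2%:R)).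
Proof.
rewrite !big_ord_recl big_ord0 Monoid.mulm1.
by congr (op _ (op (F _) (F _))); apply: val_inj.
Qed.

Section Lines.
Variable K : fieldType.
Implicit Types (l : {mpoly K[3]}) (P Q : coords K).

Lemma homog1E n (l : {mpoly K[n]}) : l \is 1.-homog -> l = \sum_i l@_U_(i) *: 'X_i.
Proof.
move=> hl; apply/mpolyP => m; rewrite raddf_sum /=.
have [/mdeg1P[i /eqP ->]|ne] := boolP (mdeg m == 1)%N.
  rewrite (bigD1 i) //= big1 => [|j ne]; rewrite mcoeffZ mcoeffXU.
    by rewrite eqxx mulr1 addr0.
  by rewrite (negPf ne) mulr0.
rewrite (dhomog_nemf_coeff hl ne) big1 // => i _; rewrite mcoeffZ mcoeffX.
by case: eqP => [e|_]; [rewrite -e mdeg1 in ne | rewrite mulr0].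
Qed.

Definition linear_coefs n (l : {mpoly K[n]}) : 'rV[K]_n := \row_i l@_U_(i).

Lemma linear_coefs_inj n : {in 1.-homog &, injective (@linear_coefs n)}.
Proof.
move=> l l' hl hl' /rowP e; rewrite (homog1E hl) (homog1E hl'); apply: eq_bigr => i _.
by have := e i; rewrite !mxE => ->.
Qed.

Lemma linear_coefsZ n c (l : {mpoly K[n]}) : linear_coefs (c *: l) = c *: linear_coefs l.
Proof. by apply/rowP => i; rewrite !mxE mcoeffZ. Qed.

Lemma linear_coefs_mulmx n (l : {mpoly K[n]}) (P : 'I_n -> K) : l \is 1.-homog ->
  \row_i P i *m (linear_coefs l)^T = (l.@[P])%:M.
Proof.
move=> /homog1E {2}->; apply/rowP => i; rewrite ord1 !mxE raddf_sum mulr1n.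
by apply: eq_bigr => j _; rewrite !mxE /= mevalZ mevalXU mulrC.
Qed.

Lemma linear_coefs_neq0 n (l : {mpoly K[n]}) : l != 0 -> l \is 1.-homog -> linear_coefs l != 0.
Proof.
move=> nzl hl; apply: contraNneq nzl => l0; apply/eqP/linear_coefs_inj; rewrite ?dhomog0 //.
by rewrite l0 -[X in linear_coefs X](scale0r 0) linear_coefsZ scale0r.
Qed.

Lemma row_neq0 n (P : 'I_n -> K) : (exists i, P i != 0) -> \row_i P i != 0.
Proof. by move=> [i nz]; apply: contraNneq nz => /rowP/(_ i); rewrite !mxE => ->. Qed.

Lemma rank_col_mx_gt1 n (v w : 'rV[K]_n) :
  v != 0 -> (forall c, w != c *: v) -> (1 < \rank (col_mx v w))%N.
Proof.
move=> nzv not_mul; rewrite -addsmxE ltnNge; apply/negP => le1.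
have : (v + w <= v)%MS by rewrite -(geq_leqif (mxrank_leqif_sup (addsmxSl v w))) rank_rV nzv.
case/(submx_trans (addsmxSr v w))/sub_rVP => c /eqP.
exact/negP/not_mul.
Qed.

Lemma rank1_rows_proportional m n (A : 'M[K]_(m, n)) (v w : 'rV[K]_n) :
  (\rank A <= 1)%N -> v != 0 -> (v <= A)%MS -> (w <= A)%MS -> exists c, w = c *: v.
Proof.
move=> rankA nzv vA wA; apply/sub_rVP; apply: submx_trans wA _.
by rewrite -(geq_leqif (mxrank_leqif_sup vA)) rank_rV nzv.
Qed.

(* The common zeros of two independent linear forms in three variables make up
   the row kernel of a matrix of rank two, hence a line of vectors. *)
Lemma lines_meet_once l l' P Q : is_line l -> is_line l' -> ~ same_line l l' ->
  nonzero_pt P -> nonzero_pt Q -> l.@[P] = 0 -> l'.@[P] = 0 ->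
  l.@[Q] = 0 -> l'.@[Q] = 0 -> same_pt P Q.
Proof.
move=> [nzl hl] [nzl' hl'] nsame /row_neq0 nzP /row_neq0 nzQ lP l'P lQ l'Q.
pose A := col_mx (linear_coefs l) (linear_coefs l').
have in_ker (R : coords K) : l.@[R] = 0 -> l'.@[R] = 0 -> (\row_i R i <= kermx A^T)%MS.
  move=> lR l'R; apply/sub_kermxP; rewrite tr_col_mx mul_mx_row !linear_coefs_mulmx //.
  by rewrite lR l'R raddf0 row_mx0.
have rank_ker : (\rank (kermx A^T) <= 1)%N.
  rewrite mxrank_ker mxrank_tr leq_subLR addn1 ltnS.
  apply: rank_col_mx_gt1 (linear_coefs_neq0 nzl hl) _ => c; apply/eqP => e; apply: nsame.
  exists c; split; last by apply: linear_coefs_inj; rewrite ?dhomogZ // linear_coefsZ.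
  by apply: contraNneq (linear_coefs_neq0 nzl' hl') => c0; rewrite e c0 scale0r.
have [c QcP] := rank1_rows_proportional rank_ker nzP (in_ker P lP l'P) (in_ker Q lQ l'Q).
exists c; split=> [|i]; last by have /rowP/(_ i) := QcP; rewrite !mxE.
by apply: contraNneq nzQ => c0; rewrite QcP c0 scale0r.
Qed.

End Lines.

Section Dehomogenization.
Variable K : fieldType.
Local Notation bipoly := {poly {poly K}}.
Local Notation form := {mpoly K[3]}.
Implicit Types (f g l : form) (A B : bipoly) (P : coords K) (m : 'X_{1..3}).

Definition constXY : {rmorphism K -> bipoly} := (@polyC {poly K}) \o (@polyC K).

Definition affine_coord (i : 'I_3) : bipoly := nth 1 [:: 'X; 'Y] i.

Definition dehom : {rmorphism form -> bipoly} := mmap constXY affine_coord.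

Definition aff P : K * K := (P 0 / P 2%:R, P 1 / P 2%:R).

Lemma dehomE f : dehom f = \sum_(m <- msupp f) (f@_m)%:P%:P * ('X ^+ m 0 * 'Y ^+ m 1).
Proof.
by apply: eq_bigr => m _; rewrite /mmap1 big_ord3 /affine_coord /= expr1n mulr1.
Qed.

Lemma dehomZ c f : dehom (c *: f) = c%:P%:P * dehom f.
Proof. exact: mmapZ. Qed.

Lemma tdsize_dehom n f : f \is n.-homog -> (tdsize (dehom f) <= n.+1)%N.
Proof.
move=> /dhomogP hf; rewrite dehomE big_seq; apply: tdsize_sum_leq => m /hf dm.
have {dm} <- : mdeg m = n := dm.
have le_deg : (m 0%R + m 1%R <= mdeg m)%N by rewrite mdegE big_ord3 /= addnA leq_addr.
apply: (@tdsizeM_leq _ _ _ 0); first by rewrite tdsizeC size_polyC_leq1.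
apply: leq_trans (_ : _ <= (m 0%R + m 1%R).+1)%N _; last by rewrite ltnS.
apply: tdsizeM_leq; apply: tdsizeX_leq; last by rewrite tdsizeC size_polyX.
by rewrite -[X in tdsize X]addr0 -polyC0 tdsize_XaddC ?size_poly0.
Qed.

Lemma eq_mnm3 m m' : mdeg m = mdeg m' -> m 0 = m' 0 -> m 1 = m' 1 -> m = m'.
Proof.
rewrite !mdegE !big_ord3 /= => e e0 e1; apply/mnmP => -[[|[|[|//]]] lt_i3].
- by rewrite (_ : Ordinal _ = 0); last apply: val_inj.
- by rewrite (_ : Ordinal _ = 1); last apply: val_inj.
rewrite (_ : Ordinal _ = 2%:R); last exact: val_inj.
by move: e; rewrite e0 e1 => /addnI/addnI.
Qed.

Lemma coef_dehom n f m : f \is n.-homog -> mdeg m = n -> (dehom f)`_(m 0)`_(m 1) = f@_m.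
Proof.
move=> /dhomogP hf dm; rewrite {1}dehomE !coef_sum.
transitivity (\sum_(m' <- msupp f) f@_m' * (m' == m)%:R).
  apply: eq_big_seq => m' /hf dm'.
  rewrite !coefCM -polyC_exp coefMC coefXn mulr_natl coefMn coefXn -mulrnA mulnb.
  congr (_ * _%:R); congr (nat_of_bool _).
  apply/idP/eqP => [/andP[/eqP e1 /eqP e0]|->]; last by rewrite !eqxx.
  by apply: eq_mnm3; rewrite // dm; apply: dm'.
rewrite {3}(mpolyE f) raddf_sum; apply: eq_bigr => m' _.
by rewrite /= mcoeffZ mcoeffX.
Qed.

Definition homogenize n A : form :=
  \sum_(m : 'X_{1..3 < n.+1} | mdeg m == n) A`_(m 0)`_(m 1) *: 'X_[m].

Lemma homogenize_homog n A : homogenize n A \is n.-homog.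
Proof. by apply: rpred_sum => m dm; rewrite dhomogZ // dhomogX. Qed.

Lemma mcoeff_homogenize n A m : mdeg m = n -> (homogenize n A)@_m = A`_(m 0)`_(m 1).
Proof.
move=> dm; have lt_m : (mdeg m < n.+1)%N by rewrite dm.
rewrite raddf_sum (bigD1 (Sub m lt_m)) /= ?dm // mcoeffZ mcoeffX eqxx mulr1.
rewrite big1 ?addr0 // => m' /andP[_ ne]; rewrite mcoeffZ mcoeffX.
by move: ne; rewrite -val_eqE /= => /negPf->; rewrite mulr0.
Qed.

Fact homogenize_is_zmod_morphism n : zmod_morphism (homogenize n).
Proof.
move=> A B; rewrite /homogenize -sumrB; apply: eq_bigr => m _.
by rewrite !coefB scalerBl.
Qed.

HB.instance Definition _ n := GRing.isZmodMorphism.Build bipoly form (homogenize n)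
  (homogenize_is_zmod_morphism n).

Lemma dehomK n f : f \is n.-homog -> homogenize n (dehom f) = f.
Proof.
move=> hf; apply/mpolyP => m; have [dm|ne] := eqVneq (mdeg m) n.
  by rewrite mcoeff_homogenize // (coef_dehom hf).
by rewrite (dhomog_nemf_coeff hf ne) (dhomog_nemf_coeff (homogenize_homog _ _) ne).
Qed.

Lemma homogenizeK n A : (tdsize A <= n.+1)%N -> dehom (homogenize n A) = A.
Proof.
move=> sA; apply/polyP => i; apply/polyP => j.
have hA := homogenize_homog n A.
have [le_n|lt_n] := leqP (i + j) n; last first.
  by rewrite (tdsize_coef_eq0 sA) // (tdsize_coef_eq0 (tdsize_dehom hA)).
pose m : 'X_{1..3} := [multinom nth 0%N [:: i; j; n - (i + j)] t | t < 3]%N.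
have [m0 m1] : m 0 = i /\ m 1 = j by rewrite !mnmE.
have dm : mdeg m = n by rewrite mdegE big_ord3 /= !mnmE /= addnA subnKC.
by rewrite -m0 -m1 (coef_dehom hA dm) mcoeff_homogenize.
Qed.

Lemma homogenizeZ n c A : homogenize n (c%:P%:P * A) = c *: homogenize n A.
Proof. by rewrite scaler_sumr; apply: eq_bigr => m _; rewrite !coefCM scalerA. Qed.

Lemma homogenizeM d e A B : (tdsize A <= d.+1)%N -> (tdsize B <= e.+1)%N ->
  homogenize (d + e) (A * B) = homogenize d A * homogenize e B.
Proof.
move=> sA sB; rewrite -{1}(homogenizeK sA) -{1}(homogenizeK sB) -rmorphM dehomK //.
by rewrite dhomogM // homogenize_homog.
Qed.

Lemma homogenizeX n A : (tdsize A <= 2)%N -> homogenize n (A ^+ n) = homogenize 1 A ^+ n.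
Proof.
move=> sA; rewrite -{1}(homogenizeK sA) -rmorphXn dehomK //.
exact/dhomog1_exp/homogenize_homog.
Qed.

Section Point.
Variable P : coords K.
Hypothesis P2 : P 2%:R != 0.

Lemma meval_dehom n f : f \is n.-homog ->
  f.@[P] = P 2%:R ^+ n * (dehom f).[(aff P).1, (aff P).2].
Proof.
move=> /dhomogP hf; rewrite dehomE mevalE !horner_sum mulr_sumr big_seq [RHS]big_seq.
apply: eq_bigr => m /hf dm; have {dm} <- : mdeg m = n := dm.
rewrite !hornerE big_ord3 mdegE big_ord3 /= !exprD !expr_div_n.
by field; rewrite !expf_neq0.
Qed.

Lemma mult_ge1_homogenize A : (tdsize A <= 2)%N ->
  mult_ge (aff P) 1 A = ((homogenize 1 A).@[P] == 0).
Proof.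
move=> sA; rewrite mult_ge1 (meval_dehom (homogenize_homog 1 A)) homogenizeK //.
by rewrite mulf_eq0 expf_eq0 (negPf P2).
Qed.

Lemma lin_at_homogenize A : (tdsize A <= 2)%N -> mult_ge (aff P) 1 A ->
  lin_at P (homogenize 1 A).
Proof.
move=> sA; rewrite mult_ge1_homogenize // => /eqP AP.
by split; first exact: homogenize_homog.
Qed.

Lemma mult_ge_dehom k f : in_Ipow P k f -> mult_ge (aff P) k (dehom f).
Proof.
case=> m [g [L [hL ->]]]; rewrite rmorph_sum.
apply: (big_ind (mult_ge (aff P) k)) => [|A B|j _]; first exact: mult_ge_poly0.
  exact: mult_geD.
rewrite rmorphM rmorph_prod; apply: mult_ge_mull.
have : mult_ge (aff P) (\sum_(i < k) 1) (\prod_(i < k) dehom (L j i)).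
  apply: (big_ind2 (mult_ge (aff P))) => [|d A e B|i _]; first exact: mult_ge0.
    exact: mult_geM.
  have [hl lP] := hL j i.
  by rewrite mult_ge1_homogenize ?tdsize_dehom // dehomK // lP.
by rewrite sum1_card card_ord.
Qed.

Lemma in_Ipow_homogenize_term n k j (c : {poly K}) :
  ('X - (aff P).2%:P) ^+ (k - j) %| c -> (c != 0 -> (size c + j <= n.+1)%N) ->
  in_Ipow P k (homogenize n (c%:P * ('X - (aff P).1%:P%:P) ^+ j)).
Proof.
have [->|nzc] := eqVneq c 0; first by rewrite mul0r raddf0 => *; apply: in_Ipow_poly0.
case/dvdpP=> c' ec; move: (nzc); rewrite ec mulf_eq0 negb_or => /andP[nzc' _] /(_ isT).
rewrite size_mul ?expf_neq0 ?polyXsubC_eq0 // size_exp_XsubC addnS /= => sc.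
set X := 'X - (aff P).1%:P%:P; set Y := 'X - (aff P).2%:P; set e := (k - j)%N in sc *.
have sX : (tdsize X <= 2)%N.
  by rewrite /X -!polyCN tdsize_XaddC // (leq_trans (size_polyC_leq1 _)).
have sY : (tdsize Y%:P <= 2)%N by rewrite tdsizeC size_XsubC.
have -> : (c' * Y ^+ e)%:P * X ^+ j = X ^+ j * (Y%:P ^+ e * c'%:P).
  by rewrite mulrC -polyC_exp -polyCM [c' * _]mulrC.
have [d en sc'] : exists2 d, n = (j + (e + d))%N & (tdsize c'%:P <= d.+1)%N.
  rewrite -size_poly_gt0 in nzc'; exists (n - (j + e))%N; rewrite ?tdsizeC;
    move: (size c') nzc' sc; lia.
have sYc := tdsizeM_leq (tdsizeX_leq e sY) sc'.
rewrite en (homogenizeM (tdsizeX_leq j sX) sYc) (homogenizeM (tdsizeX_leq e sY) sc').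
rewrite (homogenizeX j sX) (homogenizeX e sY).
apply: (@in_Ipow_leq _ _ (j + (e + 0))); first by rewrite /e; lia.
have atX : lin_at P (homogenize 1 X).
  by apply: lin_at_homogenize; rewrite // mult_ge1 !hornerE subrr.
have atY : lin_at P (homogenize 1 Y%:P).
  by apply: lin_at_homogenize; rewrite // mult_ge1 !hornerE subrr.
by do 2 apply: in_Ipow_mul_lin_at_exp => //; apply: in_Ipow0.
Qed.

Lemma in_Ipow_homogenize n k A : (tdsize A <= n.+1)%N -> mult_ge (aff P) k A ->
  in_Ipow P k (homogenize n A).
Proof.
move=> sA kA; rewrite (shiftX_taylor (aff P).1 A).
apply: (big_ind (fun B => in_Ipow P k (homogenize n B))) => [|B C|j _].
- by rewrite raddf0; apply: in_Ipow_poly0.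
- by rewrite raddfD; apply: in_IpowD.
apply: in_Ipow_homogenize_term => [|nz]; first exact: mult_ge_coef kA _.
exact: leq_trans (tdsize_coef nz) (leq_trans (tdsize_shiftX _ _) sA).
Qed.

End Point.
End Dehomogenization.

Arguments dehom {K}.

Section AffineLines.
Variable K : fieldType.
Local Notation bipoly := {poly {poly K}}.
Implicit Types (l : bipoly) (ls : seq bipoly).

Lemma is_line_homogenize l : affine_line l -> is_line (homogenize 1 l).
Proof.
move=> line_l; split; last exact: homogenize_homog.
apply: contraNneq (affine_line_neq0 line_l) => l0.
by rewrite -(homogenizeK (eq_leq (eqP line_l))) l0 rmorph0.
Qed.

Lemma same_line_homogenize l l' : affine_line l -> affine_line l' ->
  same_line (homogenize 1 l) (homogenize 1 l') <-> proportional l l'.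
Proof.
move=> /eqP/eq_leq sl /eqP/eq_leq sl'; split=> [[c [nzc e]]|[c nzc ->]]; exists c => //.
  by rewrite -(homogenizeK sl') e dehomZ (homogenizeK sl).
by rewrite homogenizeZ.
Qed.

Variables (r : nat) (Z : 'I_r -> coords K).
Hypothesis Z2 : forall s, Z s 2%:R != 0.

Lemma collinear_homogenize l : affine_line l -> (forall s, mult_ge (aff (Z s)) 1 l) ->
  collinear Z.
Proof.
move=> line_l lZ; have [nzl hl] := is_line_homogenize line_l.
exists (homogenize 1 l); split=> //; split=> // s.
by apply/eqP; rewrite -mult_ge1_homogenize ?(eqP line_l).
Qed.

Lemma is_intersection_set_homogenize ls : all affine_line ls ->
  (forall s, exists l l', [/\ l \in ls, l' \in ls, mult_ge (aff (Z s)) 1 l,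
     mult_ge (aff (Z s)) 1 l' & ~ proportional l l']) ->
  {in ls &, forall l l', ~ proportional l l' ->
     exists s, mult_ge (aff (Z s)) 1 l /\ mult_ge (aff (Z s)) 1 l'} ->
  is_intersection_set Z (fun i : 'I_(size ls) => homogenize 1 (tnth (in_tuple ls) i)).
Proof.
move=> line_ls onZ meetZ; set L := fun i => homogenize 1 _.
have line_l i : affine_line (tnth (in_tuple ls) i) by apply: (allP line_ls); apply: mem_tnth.
have same_L i j := same_line_homogenize (line_l i) (line_l j).
have on_L i s : mult_ge (aff (Z s)) 1 (tnth (in_tuple ls) i) = ((L i).@[Z s] == 0).
  by rewrite mult_ge1_homogenize // (eqP (line_l i)).
split=> [i|]; first exact: is_line_homogenize.
split=> [s|P nzP [i [j [nsame [LP L'P]]]]].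
  have [l [l' [/(tnthP (in_tuple ls))[i ->] /(tnthP (in_tuple ls))[j ->]]]] := onZ s.
  by rewrite !on_L => /eqP Ls /eqP L's npar; exists i, j; split=> // /same_L.
have [|s []] := meetZ _ _ (mem_tnth i (in_tuple ls)) (mem_tnth j (in_tuple ls)).
  by move/same_L.
rewrite !on_L => /eqP Ls /eqP L's; exists s.
have line_L t : is_line (L t) := is_line_homogenize (line_l t).
by apply: (lines_meet_once (line_L i) (line_L j) nsame) => //; exists 2%:R.
Qed.

Lemma is_alpha_affine k d : is_alpha (in_IkZ Z k) d ->
  (exists2 A, tdsize A = d.+1 & forall s, mult_ge (aff (Z s)) k A) /\
  (forall A, (tdsize A <= d)%N -> (forall s, mult_ge (aff (Z s)) k A) -> A = 0).
Proof.
case=> [[f [nzf [hf If]]] min_d].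
have minA A : (tdsize A <= d)%N -> (forall s, mult_ge (aff (Z s)) k A) -> A = 0.
  case: d hf min_d => [|n] _ min_n; first by rewrite leqn0 tdsize_eq0 => /eqP.
  move=> sA kA; suff hA0 : homogenize n A = 0 by rewrite -(homogenizeK sA) hA0 rmorph0.
  by apply: (min_n n) => // [|s]; [apply: homogenize_homog | apply: in_Ipow_homogenize].
split=> //; have mult_f s : mult_ge (aff (Z s)) k (dehom f) by apply: mult_ge_dehom.
exists (dehom f) => //; apply/eqP; rewrite eqn_leq tdsize_dehom //= ltnNge.
apply/negP => /minA/(_ mult_f) f0; case/eqP: nzf.
by rewrite -(dehomK hf) [dehom f]f0 raddf0.
Qed.

End AffineLines.

(* The second condition separates the linear factors that the points of [Z]
   contribute to a resultant. *)
Definition good_position (K : fieldType) (r : nat) (Z : 'I_r -> coords K) :=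
  (forall s, Z s 2%:R != 0) /\
  (forall s t, (aff (Z s)).2 = (aff (Z t)).2 -> aff (Z s) = aff (Z t)).

Lemma arrangement_good_position (K : closedFieldType) (r : nat) (Z : 'I_r -> coords K) k a :
  [pchar K] =i pred0 -> good_position Z -> (0 < k)%N ->
  is_alpha (in_IkZ Z k.-1) a -> is_alpha (in_IkZ Z k) a.+1 ->
  collinear Z \/ exists m (L : 'I_m -> {mpoly K[3]}), is_intersection_set Z L.
Proof.
move=> char0 [Z2 inj_Z] k_gt0 /(is_alpha_affine Z2)[_ minA] /(is_alpha_affine Z2)[[f sf mult_f] _].
pose S := undup [seq aff (Z s) | s : 'I_r].
have S_Z s : aff (Z s) \in S by rewrite mem_undup map_f ?mem_enum.
have Z_S p : p \in S -> exists s, p = aff (Z s).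
  by rewrite mem_undup => /mapP[s _ ->]; exists s.
have uniqS : uniq (map snd S).
  by rewrite map_inj_in_uniq ?undup_uniq // => p q /Z_S[s ->] /Z_S[t ->]; apply: inj_Z.
have extremal_f : extremal_curve S k a f.
  split=> // [p /Z_S[s ->] //|g sg mg]; apply: minA => // s.
  exact/mg/S_Z.
have [ls [line_ls alt]] := affine_arrangement char0 uniqS k_gt0 extremal_f.
case: alt => [[l /(allP line_ls) line_l lS]|[onS meetS]]; [left | right].
  by apply: collinear_homogenize line_l _ => // s; apply: lS.
eexists; eexists; apply: is_intersection_set_homogenize line_ls _ _ => // [s|l l' l_in l'_in npar].
  exact/onS/S_Z.
by have [p [/Z_S[s ->] pl pl']] := meetS _ _ l_in l'_in npar; exists s.
Qed.

(** * Generic coordinates *)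

Section GenericCoordinates.
Variable K : closedFieldType.

(* The moment curve [(b ^ n, ..., b, 1)] lies on none of finitely many hyperplanes
   for generic [b]. *)
Lemma linear_form_avoiding (I : finType) n (v : I -> 'I_n.+1 -> K) :
  exists2 w : 'I_n.+1 -> K, w ord_max = 1 &
    forall i, (exists j, v i j != 0) -> \sum_j w j * v i j != 0.
Proof.
pose F i := rVpoly (\row_j v i (rev_ord j)).
have /closed_nonrootP[b] : \prod_(i | F i != 0) F i != 0 by apply/prodf_neq0.
rewrite rootE horner_prod => /prodf_neq0 Fb.
exists (fun j => b ^+ rev_ord j) => [|i [j nz]]; first by rewrite /= subnn.
have Fi : F i != 0.
  apply: contraNneq nz => /(congr1 (fun p : {poly K} => p`_(rev_ord j))).
  by rewrite coef_rVpoly_ord mxE rev_ordK coef0 => ->.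
have := Fb i Fi; rewrite horner_poly (reindex_inj rev_ord_inj); congr (_ != 0).
by apply: eq_bigr => t _; rewrite valK mxE rev_ordK mulrC.
Qed.

Lemma good_position_exists (r : nat) (Z : 'I_r -> coords K) :
  (forall s, nonzero_pt (Z s)) ->
  exists2 N : 'M[K]_3, N \in unitmx & good_position (fun s => lin_act N (Z s)).
Proof.
move=> nzZ; have [w w2 wZ] := linear_form_avoiding Z.
pose u s := \sum_j w j * Z s j.
pose v (st : 'I_r * 'I_r) (i : 'I_2) :=
  [:: Z st.1 0 / u st.1 - Z st.2 0 / u st.2; Z st.1 1 / u st.1 - Z st.2 1 / u st.2]`_i.
have [c c1 cv] := linear_form_avoiding v.
pose N : 'M[K]_3 := \matrix_(i, j)
  nth 0 (nth [::] [:: [:: 1; 0; 0]; [:: c 0; 1; 0]; [:: w 0; w 1; 1]] i) j.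
have N0 s : lin_act N (Z s) 0 = Z s 0.
  by rewrite /lin_act big_ord3 !mxE /= mul1r !mul0r !addr0.
have N1 s : lin_act N (Z s) 1 = c 0 * Z s 0 + Z s 1.
  by rewrite /lin_act big_ord3 !mxE /= mul1r mul0r addr0.
have N2 s : lin_act N (Z s) 2%:R = u s.
  rewrite /lin_act /u !big_ord3 !mxE /=; congr (_ + (_ + _ * _)).
  by rewrite -w2; congr (w _); apply: val_inj.
exists N.
  rewrite unitmxE det_trig; last by apply/is_trig_mxP => -[[|[|[]]]//?] [[|[|[]]]//?]; rewrite mxE.
  by rewrite big_ord3 !mxE /= !mul1r unitr1.
split=> [s|s t]; first by rewrite N2 wZ //; apply: nzZ.
rewrite /aff !N0 !N1 !N2 /= => e.
have cv0 : \sum_j c j * v (s, t) j = 0.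
  rewrite big_ord_recr big_ord1 c1 (_ : widen_ord _ _ = 0); last exact: val_inj.
  transitivity ((c 0 * Z s 0 + Z s 1) / u s - (c 0 * Z t 0 + Z t 1) / u t); last first.
    by rewrite e subrr.
  by rewrite /v /=; ring.
have v0 : v (s, t) 0 = 0.
  apply/eqP; apply: contraTT isT => nz; have /eqP[] := cv (s, t) (ex_intro _ 0 nz).
  exact: cv0.
by congr (_, _); first exact: subr0_eq v0.
Qed.

End GenericCoordinates.

Theorem theorem3p4 (K : closedFieldType) (Hchar : [pchar K] =i pred0)
    (r : nat) (Z : 'I_r -> coords K) (HZ : forall s, nonzero_pt (Z s))
    (k : nat) (Hk : (2 <= k)%N) (a : nat)
    (Ha1 : is_alpha (in_IkZ Z k.-1) a)
    (Ha2 : is_alpha (in_IkZ Z k) a.+1) :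
  collinear Z \/ exists (m : nat) (L : 'I_m -> {mpoly K[3]}), is_intersection_set Z L.
Proof.
have [N N_unit NZ] := good_position_exists HZ.
case: (arrangement_good_position Hchar NZ (ltnW Hk)
  (is_alpha_lin_act N_unit Ha1) (is_alpha_lin_act N_unit Ha2)) => [col|[m [L NZ_L]]].
  by left; apply: (collinear_lin_act (Z := Z) N_unit).
by right; exists m, (lin_subst N \o L); apply: is_intersection_set_lin_act.
Qed.
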